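(* Let $n\ge 3$ and let $(\mathcal X,w)$ be a fully symmetric finite weighted set in $\mathbb R^n\setminus\{0\}$ with norm spectrum $R$, whose weight function takes a constant value $w_r$ on each layer $\mathcal X_r=\mathcal X\cap S^{n-1}_r$. Define $f_{4,2}=x_1^4-6x_1^2x_2^2+x_2^4$, $f_{6,3}=2(x_1^6+x_2^6+x_3^6)-15(x_1^4x_2^2+x_1^2x_2^4+x_1^4x_3^2+x_1^2x_3^4+x_2^4x_3^2+x_2^2x_3^4)+180x_1^2x_2^2x_3^2$, $f_{8,2}=x_1^8-28x_1^6x_2^2+70x_1^4x_2^4-28x_1^2x_2^6+x_2^8$, $f_{8,4}=3\sum_{i=1}^4x_i^8-28\sum_{i\ne j}x_i^6x_j^2+210\sum x_i^4x_j^2x_k^2-3780x_1^2x_2^2x_3^2x_4^2$, where the second sum is over ordered pairs of distinct $i,j\in\{1,2,3,4\}$ and the third over $i\in\{1,2,3,4\}$ and unordered pairs $\{j,k\}\subseteq\{1,2,3,4\}\setminus\{i\}$. Then: 1. $(\mathcal X,w)$ is at least a Euclidean $3$-design. 2. $(\mathcal X,w)$ is a Euclidean $5$-design iff $\sum_{r\in R}\sum_{x\in\mathcal X_r}w_rf_{4,2}(x)=0$. 3. $(\mathcal X,w)$ is a Euclidean $7$-design iff $\sum_{r\in R}\sum_{x\in\mathcal X_r}w_r r^{2s_1}f_{4,2}(x)=0$ for $s_1=0,1$ and $\sum_{r\in R}\sum_{x\in\mathcal X_r}w_rf_{6,3}(x)=0$. 4. $(\mathcal X,w)$ is a Euclidean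 $9$-design iff $\sum_{r\in R}\sum_{x\in\mathcal X_r}w_r r^{2s_1}f_{4,2}(x)=0$ for $s_1=0,1,2$, $\sum_{r\in R}\sum_{x\in\mathcal X_r}w_r r^{2s_2}f_{6,3}(x)=0$ for $s_2=0,1$, $\sum_{r\in R}\sum_{x\in\mathcal X_r}w_rf_{8,2}(x)=0$, and $\sum_{r\in R}\sum_{x\in\mathcal X_r}w_rf_{8,4}(x)=0$.
   Context: The hyperoctahedral group $H$ is the subgroup of $O(n)$ generated by all coordinate transpositions and all reflections in coordinate hyperplanes. A weighted set $(\mathcal X,w)$ (finite $\mathcal X\subset\mathbb R^n$, positive weights) is fully symmetric if $\mathcal X^g=\mathcal X$ for all $g\in H$ and $w(x)=w(y)$ whenever $x=y^g$ for some $g\in H$. Norm spectrum: $R=\{\|x\|:x\in\mathcal X\}$; $W_r=\sum_{x\in\mathcal X_r}w(x)$. $(\mathcal X,w)$ is a Euclidean $t$-design if $\sum_{r\in R}W_r\overline f_{S^{n-1}_r}=\sum_{x\in\mathcal X}w(x)f(x)$ for every real polynomial $f$ of total degree at most $t$, where $\overline f_{S^{n-1}_r}$ is the average of $f$ over the sphere of radius $r$ centered at the origin. The polynomials above are evaluated at $x\in\mathbb R^n$ through its first two, three or four coordinates.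
   Formalization: Item 4 (the 9-design criterion) is stated for n ≥ 4 only, because f_{8,4} uses the coordinate x_4, which does not exist in R^3 (and with x_4 = 0 its average over the sphere in R^3 is nonzero); items 1–3 are stated for all n ≥ 3. *)

(* Defs.v *)
From HB Require Import structures.
From mathcomp Require Import all_boot all_order all_algebra all_fingroup.
From mathcomp Require Import all_classical all_reals all_analysis.
From mathcomp Require mpoly.

Set Implicit Arguments.
Unset Strict Implicit.
Unset Printing Implicit Defensive.

Import Order.TTheory GRing.Theory Num.Theory.
Local Open Scope ring_scope.

Section Defs.
Variable R : realType.

Definition vnorm n (x : 'rV[R]_n) : R := Num.sqrt (\sum_(i < n) x 0 i ^+ 2).

Definition nnorm n (y : nat -> R) : R := Num.sqrt (\sum_(i < n) y i ^+ 2).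

(* Elements of the hyperoctahedral group H: signed permutations
   x |-> (x_{s(i)} * (-1)^{e i})_i.  These are exactly the elements of the
   group generated by coordinate transpositions and coordinate reflections. *)
Definition hact n (s : 'S_n) (e : 'I_n -> bool) (x : 'rV[R]_n) : 'rV[R]_n :=
  \row_i ((-1) ^+ e i * x 0 (s i)).

Definition fully_symmetric n (X : seq 'rV[R]_n) (w : 'rV[R]_n -> R) : Prop :=
  (forall s e x, (hact s e x \in X) = (x \in X)) /\
  (forall s e x y, y \in X -> x = hact s e y -> w x = w y).

Definition spectrum n (X : seq 'rV[R]_n) : seq R := undup (map (@vnorm n) X).
Definition layer n (X : seq 'rV[R]_n) (r : R) : seq 'rV[R]_n :=
  [seq x <- X | vnorm x == r].
Definition Wr n (X : seq 'rV[R]_n) (w : 'rV[R]_n -> R) (r : R) : R :=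
  \sum_(x <- layer X r) w x.

Definition upd (y : nat -> R) (k : nat) (t : R) : nat -> R :=
  fun i => if i == k then t else y i.

Fixpoint cube_int (k : nat) (F : (nat -> R) -> R) (y : nat -> R) : R :=
  match k with
  | 0 => F y
  | k'.+1 => (\int[lebesgue_measure]_(t in `[(-1)%R, 1%R]%classic)
                 cube_int k' F (upd y k' t))%R
  end.

Definition ball_ind n (y : nat -> R) : R := if nnorm n y <= 1 then 1 else 0.

(* Average of f over the sphere S^{n-1}_r of radius r centered at 0, w.r.t.
   the normalized surface measure, realized as the (normalized) cone measure:
   avg_{S_r} f = (1/vol(B)) * \int_B f(r y/|y|) dy, B the unit ball. *)
Definition sphere_avg n (r : R) (f : ('I_n -> R) -> R) : R :=
  cube_int n (fun y => ball_ind n y * f (fun i : 'I_n => r * y i / nnorm n y))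
           (fun _ => 0)
  / cube_int n (ball_ind n) (fun _ => 0).

Definition rvfun n (x : 'rV[R]_n) : 'I_n -> R := fun i => x 0 i.

Definition euclidean_design n (X : seq 'rV[R]_n) (w : 'rV[R]_n -> R) (t : nat)
  : Prop :=
  forall p : mpoly.mpoly n R, all (fun m => (mpoly.mdeg m <= t)%N) (mpoly.msupp p) ->
    \sum_(r <- spectrum X) Wr X w r * sphere_avg r (fun v => @mpoly.meval n R v p)
    = \sum_(x <- X) w x * @mpoly.meval n R (rvfun x) p.

(* The coordinate x_{i+1} of x (0-based index i); 0 if i >= n (never used
   when n is large enough). *)
Definition coord n (x : 'rV[R]_n) (i : nat) : R :=
  if insub i is Some j then x 0 j else 0.

Definition f42 n (x : 'rV[R]_n) : R :=
  let x1 := coord x 0 in let x2 := coord x 1 in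
  x1 ^+ 4 - 6 * x1 ^+ 2 * x2 ^+ 2 + x2 ^+ 4.

Definition f63 n (x : 'rV[R]_n) : R :=
  let x1 := coord x 0 in let x2 := coord x 1 in let x3 := coord x 2 in
  2 * (x1 ^+ 6 + x2 ^+ 6 + x3 ^+ 6)
  - 15 * (x1 ^+ 4 * x2 ^+ 2 + x1 ^+ 2 * x2 ^+ 4 + x1 ^+ 4 * x3 ^+ 2
          + x1 ^+ 2 * x3 ^+ 4 + x2 ^+ 4 * x3 ^+ 2 + x2 ^+ 2 * x3 ^+ 4)
  + 180 * x1 ^+ 2 * x2 ^+ 2 * x3 ^+ 2.

Definition f82 n (x : 'rV[R]_n) : R :=
  let x1 := coord x 0 in let x2 := coord x 1 in
  x1 ^+ 8 - 28 * x1 ^+ 6 * x2 ^+ 2 + 70 * x1 ^+ 4 * x2 ^+ 4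
  - 28 * x1 ^+ 2 * x2 ^+ 6 + x2 ^+ 8.

Definition f84 n (x : 'rV[R]_n) : R :=
  3 * (\sum_(i < 4) coord x i ^+ 8)
  - 28 * (\sum_(i < 4) \sum_(j < 4 | j != i) coord x i ^+ 6 * coord x j ^+ 2)
  + 210 * (\sum_(i < 4) \sum_(j < 4 | j != i) \sum_(k < 4 | (nat_of_ord j < nat_of_ord k)%N && (k != i))
             coord x i ^+ 4 * coord x j ^+ 2 * coord x k ^+ 2)
  - 3780 * (coord x 0 ^+ 2 * coord x 1 ^+ 2 * coord x 2 ^+ 2 * coord x 3 ^+ 2).

Definition layer_sum n (X : seq 'rV[R]_n) (w : 'rV[R]_n -> R) (s : nat)
  (f : 'rV[R]_n -> R) : R :=
  \sum_(r <- spectrum X) \sum_(x <- layer X r) w x * r ^+ (2 * s) * f x.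

End Defs.

(* Main.v *)
Require Import Defs.
From HB Require Import structures.
From mathcomp Require Import all_boot all_order all_algebra all_fingroup.
From mathcomp Require Import all_classical all_reals all_analysis.
From mathcomp Require Import measurable_realfun ring lra zify.
From mathcomp Require mpoly.
Import Order.TTheory GRing.Theory Num.Theory.
Local Open Scope ring_scope.

(** Let L_r be the average over the sphere of radius r. For an H-invariant weight
    u, the defect functional D_u(f) = sum_x u(x) (f(x) - L_|x| f) kills monomials
    with an odd exponent, depends only on the exponent pattern of the others, and
    satisfies sum_i D_u(x_i^2 f) = D_(u |x|^2)(f). In each degree 2k <= 8 these
    relations, together with the equations D_u(f) = 0 for the given harmonic
    polynomials f of degree 2k, form a linear system that forces all moments of
    degree 2k to vanish, provided D_(u |x|^2) vanishes in degree 2k - 2. Since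
    L_r f = 0 for those f, the numbers D_u(f) are the layer sums of the statement.

    The values L_r f = 0 come from invariance under the rotation by pi/4 in a
    coordinate plane, which negates f42(x_i, x_j) (x_i^2 + x_j^2)^e. The rotation is
    a product of three shears, and a shear preserves an iterated Lebesgue integral
    by Tonelli and translation invariance in one variable. *)

Set Implicit Arguments.
Unset Strict Implicit.
Unset Printing Implicit Defensive.

(** * Iterated Lebesgue integrals on real sequences, and linear maps that preserve them *)

Section SequenceSpace.
Context {R : realType}.
Local Open Scope classical_set_scope.

Definition real_seq := nat -> R.
HB.instance Definition _ := Choice.on real_seq.
HB.instance Definition _ := isPointed.Build real_seq (fun=> 0).

Definition cylinders : set (set real_seq) :=
  [set C | exists i (B : set R),
     measurable B /\ C = (fun y : real_seq => y i) @^-1` B].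

(** The product sigma-algebra. Sequences are infinite because [cube_int] integrates functions on
    [nat -> R], whatever the dimension. *)
Definition rseq : measurableType _ := g_sigma_algebraType cylinders.

Lemma measurable_proj i : measurable_fun setT (fun y : rseq => y i).
Proof.
move=> _ B mB; rewrite setTI; apply: sub_sigma_algebra.
by exists i, B.
Qed.

Lemma measurable_fun_rseq d (T : measurableType d) (h : T -> rseq) :
  (forall i, measurable_fun setT (fun t => h t i)) -> measurable_fun setT h.
Proof.
move=> mh; apply: (@measurability _ _ T rseq setT h cylinders) => // _ [_ [i [B [mB ->]]] <-].
exact: mh.
Qed.

Lemma measurable_upd d (T : measurableType d) (h : T -> rseq) (g : T -> R) k :
  measurable_fun setT h -> measurable_fun setT g ->
  measurable_fun setT (fun t => upd (h t) k (g t) : rseq).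
Proof.
move=> mh mg; apply: measurable_fun_rseq => i; rewrite /upd.
by case: (i == k) => //; exact: (measurableT_comp (measurable_proj i) mh).
Qed.

Local Notation mu := (@lebesgue_measure R).
Local Open Scope ereal_scope.

(** The variable runs over the whole line, so that translations act on it; [cube_int_eint] makes the
    link with integrals over the cube. *)
Definition eint1 (k : nat) (F : rseq -> \bar R) : rseq -> \bar R :=
  fun y => \int[mu]_t F (upd y k t).

Definition eint (s : seq nat) (F : rseq -> \bar R) : rseq -> \bar R :=
  foldr eint1 F s.

Lemma eint1_ge0 k (F : rseq -> \bar R) y : (forall z, 0 <= F z) -> 0 <= eint1 k F y.
Proof. by move=> F0; exact: integral_ge0. Qed.

(** The integrand [F (upd y k t)] is jointly measurable in [y] and [t], so Tonelli's theorem
    applies. *)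
Lemma measurable_eint1 k (F : rseq -> \bar R) : (forall z, 0 <= F z) ->
  measurable_fun setT F -> measurable_fun setT (eint1 k F).
Proof.
move=> F0 mF.
apply: (measurable_fun_fubini_tonelli_F (m2 := mu)
  (fun p : rseq * measurableTypeR R => F (upd p.1 k p.2))) => //.
exact: (measurableT_comp mF (measurable_upd k measurable_fst measurable_snd)).
Qed.

Lemma eint_ge0 s (F : rseq -> \bar R) y : (forall z, 0 <= F z) -> 0 <= eint s F y.
Proof. by move=> F0; elim: s y => //= k s IH y; exact: eint1_ge0. Qed.

Lemma measurable_eint s (F : rseq -> \bar R) : (forall z, 0 <= F z) ->
  measurable_fun setT F -> measurable_fun setT (eint s F).
Proof.
move=> F0 mF; elim: s => //= k s IH; apply: measurable_eint1 => //.
by move=> z; exact: eint_ge0.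
Qed.

Lemma updC (y : nat -> R) i j a b : i != j ->
  upd (upd y i a) j b = upd (upd y j b) i a.
Proof.
move=> ij; apply/funext => k; rewrite /upd.
by case: eqVneq => // ->; rewrite eq_sym (negbTE ij).
Qed.

Lemma updK (y : nat -> R) i a b : upd (upd y i a) i b = upd y i b.
Proof. by apply/funext => k; rewrite /upd; case: eqP. Qed.

Lemma eint1C i j (F : rseq -> \bar R) : (forall z, 0 <= F z) -> measurable_fun setT F ->
  eint1 i (eint1 j F) = eint1 j (eint1 i F).
Proof.
move=> F0 mF; have [->//|ij] := eqVneq i j.
apply/funext => y; rewrite /eint1.
pose f (p : measurableTypeR R * measurableTypeR R) := F (upd (upd y i p.1) j p.2).
have mf : measurable_fun setT f.
  apply: (measurableT_comp mF); apply: measurable_upd; last exact: measurable_snd.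
  apply: measurable_upd; last exact: measurable_fst.
  exact: measurable_cst.
transitivity (\int[mu]_t \int[mu]_u f (u, t)).
  exact: (fubini_tonelli (m1 := mu) (m2 := mu) f mf (fun p => F0 _)).
by apply: eq_integral => t _; apply: eq_integral => u _; rewrite /f /= updC.
Qed.

(** [eint1C] moves the variable [i] inwards past the later ones. The list [s'] is chosen before [F],
    so the same one serves for an integrand and for its composite with a map. *)
Lemma eint_inner s i : i \in s -> exists s', forall F : rseq -> \bar R,
  (forall z, 0 <= F z) -> measurable_fun setT F -> eint s F = eint s' (eint1 i F).
Proof.
elim: s => // k s IH; rewrite inE => /orP[/eqP <-|/IH[s' Hs']]; last first.
  by exists (k :: s') => F F0 mF /=; rewrite Hs'.
exists s => F F0 mF /=; elim: s {IH} => //= j s IH.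
rewrite eint1C ?IH //; first by move=> z; exact: eint_ge0.
exact: measurable_eint.
Qed.

(** The image of Lebesgue measure under a reflection or translation gives each half-open interval
    its length, so it is Lebesgue measure by uniqueness. *)
Lemma lebesgue_integral_sign_shift (b : bool) (a : R) (f : R -> \bar R) :
  (forall x, 0 <= f x) -> measurable_fun [set: R] f ->
  \int[mu]_x f ((-1) ^+ b * x + a)%R = \int[mu]_x f x.
Proof.
move=> f0 mf; pose phi (x : measurableTypeR R) : measurableTypeR R := ((-1) ^+ b * x + a)%R.
have mphi : measurable_fun setT phi.
  by apply: measurable_funD => //; apply: measurable_funM.
rewrite -[LHS]/(\int[mu]_(x in phi @^-1` setT) (f \o phi) x).
rewrite -ge0_integral_pushforward //.
apply: eq_measure_integral => //= A mA _.
apply/esym/lebesgue_measure_unique => //= _ [[c d]] _ <-.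
rewrite /pushforward /phi.
case: b {phi mphi}.
  rewrite (_ : _ @^-1` _ = `[(a - d)%R, (a - c)%R[); last first.
    by apply/seteqP; split => x /=; rewrite !in_itv /= expr1 => ?; lra.
  rewrite !lebesgue_measure_itv /= !lte_fin (_ : (a - d < a - c)%R = (c < d)%R); last first.
    by apply/idP/idP => ?; lra.
  by case: ifP => // _; rewrite -!EFinD; congr EFin; lra.
rewrite (_ : _ @^-1` _ = `](c - a)%R, (d - a)%R]); last first.
  by apply/seteqP; split => x /=; rewrite !in_itv /= expr0 => ?; lra.
rewrite !lebesgue_measure_itv /= !lte_fin (_ : (c - a < d - a)%R = (c < d)%R); last first.
  by apply/idP/idP => ?; lra.
by case: ifP => // _; rewrite -!EFinD; congr EFin; lra.
Qed.

(** The matrix with rows (a, b) and (c, d) acting on the coordinates [i] and [j]. The index type is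
    arbitrary so that the formula acts both on sequences and on vectors indexed by ['I_n]. *)
Definition plane (I : eqType) (i j : I) (a b c d : R) (y : I -> R) : I -> R :=
  fun k => if k == i then (a * y i + b * y j)%R
           else if k == j then (c * y i + d * y j)%R else y k.

Lemma planeC (I : eqType) (i j : I) a b c d y : i != j ->
  plane i j a b c d y = plane j i d c b a y.
Proof.
move=> ij; apply/funext => k; rewrite /plane.
have [->|ki] := eqVneq k i; first by rewrite (negbTE ij) addrC.
by case: eqP => // _; rewrite addrC.
Qed.

Lemma plane_comp (I : eqType) (i j : I) a b c d a' b' c' d' y : i != j ->
  plane i j a b c d (plane i j a' b' c' d' y) =
  plane i j (a * a' + b * c') (a * b' + b * d')
            (c * a' + d * c') (c * b' + d * d') y.
Proof.
move=> ij; apply/funext => k; rewrite /plane !eqxx [j == i]eq_sym (negbTE ij).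
by case: eqP => // _; last (case: eqP => // _); ring.
Qed.

(** For nonnegative integrands Tonelli's theorem needs no integrability; bounded functions are
    shifted by a constant to fall in this case. *)
Definition preserving (s : seq nat) (A : rseq -> rseq) :=
  measurable_fun setT A /\
  forall F : rseq -> \bar R, (forall z, 0 <= F z) -> measurable_fun setT F ->
    eint s (F \o A) = eint s F.

Lemma preserving_comp s A B :
  preserving s A -> preserving s B -> preserving s (A \o B).
Proof.
move=> [mA pA] [mB pB]; split; first exact: (measurableT_comp mA mB).
move=> F F0 mF; rewrite -[F \o _]/((F \o A) \o B) pB ?pA // => [z|].
  exact: F0.
exact: (measurableT_comp mF mA).
Qed.

(** Only the coordinate [i] changes, by a sign and a translation by [t * y j]. With [i] as innermost
    variable, [y j] is a constant and one-variable invariance applies. *)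
Lemma preserving_shear (s : seq nat) (i j : nat) (b : bool) (t : R) : i \in s -> i != j ->
  preserving s (plane i j ((-1) ^+ b) t 0 1).
Proof.
move=> /eint_inner[s' hs'] ij.
have -> : plane i j ((-1) ^+ b) t 0 1 =
    fun y : rseq => upd y i ((-1) ^+ b * y i + t * y j)%R.
  apply/funext => y; apply/funext => k; rewrite /plane /upd.
  by case: eqP => // _; case: eqP => // ->; rewrite mul0r add0r mul1r.
pose A (y : rseq) : rseq := upd y i ((-1) ^+ b * y i + t * y j)%R.
rewrite -/A.
have mA : measurable_fun setT A.
  apply: measurable_upd; first exact: measurable_id.
  by apply: measurable_funD; apply: measurable_funM => //; exact: measurable_proj.
split => // F F0 mF; rewrite !hs' //; last first.
- exact: (measurableT_comp mF mA).
- by move=> z; exact: F0.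
congr eint; apply/funext => y; rewrite /eint1 /A /=.
pose f u := F (upd y i u).
rewrite -[RHS](lebesgue_integral_sign_shift b (t * y j) (f := f)); last 2 first.
- by move=> x; exact: F0.
- by apply: (measurableT_comp mF); apply: measurable_upd => //; exact: measurable_cst.
by apply: eq_integral => u _; rewrite updK /f /upd eqxx [j == i]eq_sym (negbTE ij).
Qed.

Lemma preserving_shear1 s i j (t : R) : i \in s -> i != j ->
  preserving s (plane i j 1 t 0 1).
Proof. exact: (preserving_shear false). Qed.

Lemma preserving_shear2 s i j (t : R) : j \in s -> i != j ->
  preserving s (plane i j 1 0 t 1).
Proof.
move=> js ij; rewrite (_ : plane i j 1 0 t 1 = plane j i 1 t 0 1).
  by apply: preserving_shear1 => //; rewrite eq_sym.
by apply/funext => y; rewrite planeC.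
Qed.

Lemma preserving_reflection s i j : i \in s -> i != j ->
  preserving s (plane i j (-1) 0 0 1).
Proof. exact: (preserving_shear true). Qed.

(** The two equations hold for the cosine [c] and sine [d] of an angle and the tangent [t] of its
    half; they factor the rotation into three shears. *)
Lemma preserving_rotation s i j (t c d : R) : i \in s -> j \in s -> i != j ->
  c = (1 - t * d)%R -> d = (t * (1 + c))%R ->
  preserving s (plane i j c (- d) d c).
Proof.
move=> si sj ij hc hd.
rewrite (_ : plane _ _ _ _ _ _ =
  plane i j 1 (- t) 0 1 \o (plane i j 1 0 d 1 \o plane i j 1 (- t) 0 1)).
  apply: preserving_comp; first exact: preserving_shear1.
  apply: preserving_comp; first exact: preserving_shear2.
  exact: preserving_shear1.
apply/funext => y; rewrite /= !plane_comp //; congr (plane i j _ _ _ _ y).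
- by rewrite {1}hc; ring.
- by rewrite [in LHS]hd [in LHS]hc; ring.
- ring.
- by rewrite {1}hc; ring.
Qed.

(** The swap is a quarter turn, with half-angle tangent 1, followed by a reflection. *)
Lemma preserving_swap s i j : i \in s -> j \in s -> i != j ->
  preserving s (plane i j 0 1 1 0).
Proof.
move=> si sj ij.
rewrite (_ : plane _ _ _ _ _ _ =
  plane i j (-1) 0 0 1 \o plane i j 0 (-1) 1 0).
  apply: preserving_comp; first exact: preserving_reflection.
  by apply: (preserving_rotation (t := 1)) => //; ring.
apply/funext => y; rewrite /= !plane_comp //; congr (plane i j _ _ _ _ y); ring.
Qed.

End SequenceSpace.

(** * Cube integrals of bounded measurable functions *)

Section CubeIntegral.
Context {R : realType}.
Local Open Scope classical_set_scope.
Local Notation mu := (@lebesgue_measure R).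
Local Notation D := (`[(-1)%R, 1%R]%classic).
Implicit Types F G : @rseq R -> R.

(** A class stable under sums, products and partial integration: each inner integral stays
    integrable in the next variable. *)
Definition bounded_measurable F :=
  measurable_fun setT F /\ exists M, forall y, `|F y| <= M.

Lemma bm_cst (c : R) : bounded_measurable (fun=> c).
Proof. by split; [exact: measurable_cst | exists `|c|]. Qed.

Lemma bmD F G : bounded_measurable F -> bounded_measurable G ->
  bounded_measurable (fun y => F y + G y).
Proof.
move=> [mF [M hM]] [mG [N hN]]; split; first exact: measurable_funD.
by exists (M + N) => y; rewrite (le_trans (ler_normD _ _)) // lerD.
Qed.

Lemma bmM F G : bounded_measurable F -> bounded_measurable G ->
  bounded_measurable (fun y => F y * G y).
Proof.
move=> [mF [M hM]] [mG [N hN]]; split; first exact: measurable_funM.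
by exists (M * N) => y; rewrite normrM ler_pM.
Qed.

Lemma lebesgue_cube : mu D = 2%:E.
Proof.
rewrite lebesgue_measure_itv /= lte_fin ifT; last by lra.
by rewrite -EFinD; congr EFin; lra.
Qed.

Lemma Rintegral_cube_cst (c : R) : \int[mu]_(t in D) c = c * 2.
Proof.
by rewrite Rintegral_cst //; exact: (congr1 (fun z => c * fine z) lebesgue_cube).
Qed.

Lemma measurable_upd1 (y : @rseq R) k :
  measurable_fun setT (fun t : R => upd y k t : @rseq R).
Proof. by apply: measurable_upd => //; exact: measurable_cst. Qed.

Lemma bm_integrable F (A : set R) k y : bounded_measurable F ->
  measurable A -> (mu A < +oo)%E ->
  mu.-integrable A (EFin \o (fun t => F (upd y k t))).
Proof.
move=> [mF [M hM]] mA fA; apply: measurable_bounded_integrable => //.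
  apply: measurable_funTS; exact: (measurableT_comp mF (measurable_upd1 y k)).
exists M; split; first by rewrite num_real.
by move=> x Mx t _ /=; exact: le_trans (hM _) (ltW Mx).
Qed.

Lemma bm_integrableD F k y : bounded_measurable F ->
  mu.-integrable D (EFin \o (fun t => F (upd y k t))).
Proof.
move=> bF; apply: bm_integrable => //; rewrite lebesgue_cube; exact: ltry.
Qed.

Lemma bm_cube1 F k : bounded_measurable F ->
  bounded_measurable (fun y => \int[mu]_(t in D) F (upd y k t)).
Proof.
move=> bF; have [mF [M hM]] := bF; split; last first.
  exists (M * 2) => y.
  rewrite (le_trans (le_normr_Rintegral _ (bm_integrableD k y bF))) //.
  have -> : M * 2 = \int[mu]_(t in D) M by rewrite Rintegral_cube_cst.
  apply: le_Rintegral => //.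
    by apply: integrable_norm; exact: bm_integrableD.
  exact: (bm_integrableD k y (bm_cst M)).
(* Shifting by the bound [M] and extending by zero gives a nonnegative function, to which
   [measurable_eint1] applies; the shift contributes [M * 2], as [-1, 1] has length 2. *)
pose G y := (F y + M) * \1_D (y k).
have G0 y : (0 <= (G y)%:E)%E.
  rewrite lee_fin mulr_ge0 //; have := hM y; rewrite ler_norml; lra.
have mG : measurable_fun setT (EFin \o G).
  apply/measurable_EFinP; apply: measurable_funM; first exact: measurable_funD.
  apply: (measurableT_comp _ (measurable_proj k)); exact: measurable_indic.
have -> : (fun y => \int[mu]_(t in D) F (upd y k t)) =
          (fun y => fine (eint1 k (EFin \o G) y) - M * 2).
  apply/funext => y.
  have -> : fine (eint1 k (EFin \o G) y) = \int[mu]_(t in D) (F (upd y k t) + M).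
    rewrite Rintegral_mkcond; congr fine; apply: eq_integral => t _ /=.
    rewrite /G /patch indicE /upd eqxx; congr EFin.
    by case: ifP => _; rewrite ?mulr1 ?mulr0.
  rewrite RintegralD //; [|exact: bm_integrableD|exact: (bm_integrableD k y (bm_cst M))].
  by rewrite Rintegral_cube_cst addrK.
apply: measurable_funB => //; apply: measurableT_comp.
  exact: fine_measurable.
exact: measurable_eint1.
Qed.

Lemma bm_cube_int k F : bounded_measurable F -> bounded_measurable (cube_int k F).
Proof. by move=> bF; elim: k => //= k IH; exact: bm_cube1. Qed.

Lemma cube_intD k F G y : bounded_measurable F -> bounded_measurable G ->
  cube_int k (fun z => F z + G z) y = cube_int k F y + cube_int k G y.
Proof.
move=> bF bG; elim: k y => //= k IH y.
rewrite -RintegralD //; [|exact: (bm_integrableD _ _ (bm_cube_int k bF))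
  |exact: (bm_integrableD _ _ (bm_cube_int k bG))].
by apply: eq_Rintegral => t _.
Qed.

Lemma cube_intZ k (c : R) F y : bounded_measurable F ->
  cube_int k (fun z => c * F z) y = c * cube_int k F y.
Proof.
move=> bF; elim: k y => //= k IH y.
rewrite -RintegralZl //; last exact: (bm_integrableD _ _ (bm_cube_int k bF)).
by apply: eq_Rintegral => t _.
Qed.

Lemma cube_int_eq0 k F y :
  (forall z, (forall j, (k <= j)%N -> z j = y j) -> F z = 0) -> cube_int k F y = 0.
Proof.
elim: k y => [|k IH] y hF /=; first exact: hF.
rewrite (@eq_Rintegral _ _ _ _ _ (fun=> 0)).
  by rewrite Rintegral_cube_cst mul0r.
move=> t _; apply: IH => z hz; apply: hF => j kj.
by rewrite hz ?(ltnW kj) // /upd gtn_eqF.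
Qed.

Lemma cube_int_ge0 k F y : (forall z, 0 <= F z) -> 0 <= cube_int k F y.
Proof.
by move=> F0; elim: k y => //= k IH y; apply: Rintegral_ge0 => t _; exact: IH.
Qed.

(** On the smaller cube of side [2 * e] the function is at least 1, and elsewhere it is nonnegative.
    This serves to show that the ball has positive volume. *)
Lemma cube_int_ge k F (e : R) y : bounded_measurable F -> (forall z, 0 <= F z) ->
  0 <= e <= 1 ->
  (forall z, (forall j, (j < k)%N -> `|z j| <= e) ->
             (forall j, (k <= j)%N -> z j = y j) -> 1 <= F z) ->
  (2 * e) ^+ k <= cube_int k F y.
Proof.
move=> bF F0 /andP[e0 e1]; elim: k y => [|k IH] y hF /=.
  by rewrite expr0; apply: hF.
have sub : `[(- e), e] `<=` D.
  by move=> t /=; rewrite !in_itv /= => ?; lra.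
have fin : (mu `[(- e)%R, e] < +oo)%E.
  by rewrite lebesgue_measure_itv /=; case: ifP => _; rewrite -?EFinD ltry.
have mue : fine (mu `[(- e), e]) = 2 * e.
  rewrite lebesgue_measure_itv /= lte_fin; case: ltP => /= [_|]; lra.
have bC := bm_cube_int k bF.
apply: (@le_trans _ _ (\int[mu]_(t in `[(- e), e]) cube_int k F (upd y k t))).
  have -> : (2 * e) ^+ k.+1 = \int[mu]_(t in `[(- e), e]) (2 * e) ^+ k.
    rewrite Rintegral_cst // exprSr.
    exact: (congr1 (fun z => (2 * e) ^+ k * z) (esym mue)).
  apply: le_Rintegral => //.
  - exact: (bm_integrable k y (bm_cst _)).
  - exact: bm_integrable.
  - move=> t /=; rewrite in_itv /= => te; apply: IH => z hz1 hz2; apply: hF => j.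
      rewrite ltnS leq_eqVlt => /orP[/eqP ->|]; last exact: hz1.
      by rewrite hz2 // /upd eqxx ler_norml.
    by move=> kj; rewrite hz2 ?(ltnW kj) // /upd gtn_eqF.
rewrite fine_le //.
- exact/integrable_fin_num/bm_integrable.
- exact/integrable_fin_num/bm_integrableD.
- apply: ge0_subset_integral => //.
  + by apply/measurable_EFinP; apply: measurable_funTS;
      exact: (measurableT_comp bC.1 (measurable_upd1 y k)).
  + by move=> t _; rewrite lee_fin cube_int_ge0.
Qed.

(** Since [F] vanishes once one of the first [k] coordinates leaves [-1, 1], integrating over the
    line adds nothing. The list is reversed because [cube_int] has the highest index outermost. *)
Lemma cube_int_eint k F y : bounded_measurable F -> (forall z, 0 <= F z) ->
  (forall z i, (i < k)%N -> 1 < `|z i| -> F z = 0) ->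
  (cube_int k F y)%:E = eint (rev (iota 0 k)) (EFin \o F) y.
Proof.
move=> bF F0; elim: k y => [//|k IH] y hF.
rewrite -addn1 iotaD rev_cat /= add0n addn1.
have -> : eint (rev (iota 0 k)) (EFin \o F) = EFin \o cube_int k F.
  by apply/funext => z; rewrite /= IH // => z' i ik; apply: hF; exact: ltnW.
rewrite /eint1 /= fineK; last first.
  exact/integrable_fin_num/(bm_integrableD _ _ (bm_cube_int k bF)).
rewrite integral_mkcond; apply: eq_integral => t _; rewrite /patch.
case: ifPn => // /negP tD; rewrite cube_int_eq0 // => z hz.
apply: (hF z k) => //; rewrite hz // /upd eqxx ltNge; apply/negP => t1.
by apply: tD; rewrite inE /= in_itv /= -ler_norml.
Qed.

(* Changing the integrand at the origin changes the innermost integral on a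
   null set only. *)
Lemma cube_int_neq0 k F G y : (0 < k)%N ->
  bounded_measurable F -> bounded_measurable G ->
  (forall z : @rseq R, z 0%N != 0 -> F z = G z) ->
  cube_int k F y = cube_int k G y.
Proof.
move=> + bF bG FG; case: k => // k _; elim: k y => [|k IH] y; last first.
  by apply: eq_Rintegral => t _; exact: IH.
have mf (H : @rseq R -> R) : bounded_measurable H ->
    measurable_fun (D : set R) (EFin \o (fun t : R => H (upd y 0 t))).
  move=> bH; apply/measurable_EFinP; apply: measurable_funTS.
  exact: (measurableT_comp bH.1 (measurable_upd1 y 0)).
congr fine; apply: ae_eq_integral => //=; [exact: (mf F)|exact: (mf G)|].
exists [set 0]; split => //; first exact: lebesgue_measure_set1.
move=> t /= /not_implyP[_]; apply: contra_notP => /eqP t0.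
by rewrite FG // /upd eqxx.
Qed.

End CubeIntegral.

(** * Linearity of sphere averages, and their invariance under orthogonal maps of a coordinate
    plane *)

Section SphereAverage.
Context {R : realType} (n : nat).
Implicit Types (r : R) (f g : ('I_n -> R) -> R).

(** The argument of [f] in [sphere_avg]. Where the norm is 0 its inverse is 0 by convention, and the
    value is the origin. *)
Definition radial r (y : @rseq R) : 'I_n -> R := fun i => r * y i / nnorm n y.

Definition sphere_bm r f := bounded_measurable (fun y => f (radial r y)).

Lemma nnorm_ge0 (y : nat -> R) : 0 <= nnorm n y.
Proof. exact: sqrtr_ge0. Qed.

Lemma sqr_nnorm (y : nat -> R) : nnorm n y ^+ 2 = \sum_(i < n) y i ^+ 2.
Proof. by rewrite sqr_sqrtr // sumr_ge0 // => i _; exact: sqr_ge0. Qed.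

Lemma ler_nnorm (y : nat -> R) (i : 'I_n) : `|y i| <= nnorm n y.
Proof.
rewrite -[X in X <= _]sqrtr_sqr ler_wsqrtr // (bigD1 i) //= lerDl.
by rewrite sumr_ge0 // => j _; exact: sqr_ge0.
Qed.

Lemma measurable_nnorm : measurable_fun setT (nnorm n : @rseq R -> R).
Proof.
apply: measurableT_comp.
  apply: continuous_measurable_fun; exact: sqrt_continuous.
apply: measurable_sum => i; apply: measurable_funX; exact: measurable_proj.
Qed.

Lemma measurable_nnormV : measurable_fun setT (fun y : @rseq R => (nnorm n y)^-1).
Proof.
(* On nonnegative reals, 0 included, the inverse is the power with exponent -1, which is
   measurable. *)
rewrite (_ : (fun y => _) = (fun y : @rseq R => powR (nnorm n y) (-1))).
  exact: (measurableT_comp (measurable_powR _) measurable_nnorm).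
by apply/funext => y; rewrite powR_inv1 // nnorm_ge0.
Qed.

Lemma bm_ball_ind : bounded_measurable (ball_ind n : @rseq R -> R).
Proof.
split; last first.
  by exists 1 => y; rewrite /ball_ind; case: ifP; rewrite ?normr0 ?normr1.
apply: measurable_fun_ifT => //; apply: measurable_fun_ler => //.
exact: measurable_nnorm.
Qed.

Lemma ball_ind_ge0 (y : nat -> R) : 0 <= ball_ind n y.
Proof. by rewrite /ball_ind; case: ifP. Qed.

Lemma ball_ind_out (y : nat -> R) i : (i < n)%N -> 1 < `|y i| -> ball_ind n y = 0.
Proof.
move=> lin y1; rewrite /ball_ind ifF //; apply/negbTE; rewrite -ltNge.
exact: lt_le_trans y1 (ler_nnorm y (Ordinal lin)).
Qed.

Lemma ball_vol_gt0 : 0 < cube_int n (@ball_ind R n) (fun=> 0).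
Proof.
(* The cube of half-side [e] lies in the unit ball, since n e^2 <= n e <= 1. *)
pose e : R := n.+1%:R^-1.
have e0 : 0 < e by rewrite invr_gt0 ltr0n.
have e1 : e <= 1 by rewrite invf_le1 ?ler1n ?ltr0n.
have ne : n%:R * e <= 1.
  by rewrite ler_pdivrMr ?ltr0n // mul1r ler_nat.
apply: (@lt_le_trans _ _ ((2 * e) ^+ n)); first by rewrite exprn_gt0 ?mulr_gt0.
apply: (cube_int_ge bm_ball_ind ball_ind_ge0) => [|z hz _].
  by rewrite (ltW e0).
rewrite /ball_ind ifT // -sqrtr1 ler_wsqrtr //.
apply: (@le_trans _ _ (\sum_(i < n) e)).
  apply: ler_sum => i _; have zi := hz i (ltn_ord i).
  rewrite -normr_id in zi; rewrite -real_normK ?num_real //.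
  have := normr_ge0 (z i); rewrite normr_id in zi; nra.
by rewrite sumr_const card_ord -[e *+ n]mulr_natl.
Qed.

Lemma sphere_bm_cst r (c : R) : sphere_bm r (fun=> c).
Proof. exact: bm_cst. Qed.

Lemma sphere_bmD r f g : sphere_bm r f -> sphere_bm r g ->
  sphere_bm r (fun v => f v + g v).
Proof. exact: bmD. Qed.

Lemma sphere_bmM r f g : sphere_bm r f -> sphere_bm r g ->
  sphere_bm r (fun v => f v * g v).
Proof. exact: bmM. Qed.

Lemma sphere_bm_coord r i : sphere_bm r (fun v => v i).
Proof.
split.
  apply: measurable_funM; last exact: measurable_nnormV.
  by apply: measurable_funM => //; exact: measurable_proj.
exists `|r| => y; rewrite /radial !normrM normfV -mulrA ler_piMr //.
have := nnorm_ge0 y; rewrite le_eqVlt => /orP[/eqP <-|N0].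
  by rewrite normr0 invr0 mulr0.
by rewrite (gtr0_norm N0) ler_pdivrMr // mul1r ler_nnorm.
Qed.

Lemma sphere_bm_sum (I : Type) (s : seq I) r (F : I -> ('I_n -> R) -> R) :
  (forall i, sphere_bm r (F i)) -> sphere_bm r (fun v => \sum_(i <- s) F i v).
Proof.
move=> hF; elim: s => [|i s IH].
  by under [X in sphere_bm r X]funext do rewrite big_nil; exact: sphere_bm_cst.
by under [X in sphere_bm r X]funext do rewrite big_cons; exact: sphere_bmD.
Qed.

Lemma sphere_bm_prod (I : Type) (s : seq I) r (F : I -> ('I_n -> R) -> R) :
  (forall i, sphere_bm r (F i)) -> sphere_bm r (fun v => \prod_(i <- s) F i v).
Proof.
move=> hF; elim: s => [|i s IH].
  by under [X in sphere_bm r X]funext do rewrite big_nil; exact: sphere_bm_cst.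
by under [X in sphere_bm r X]funext do rewrite big_cons; exact: sphere_bmM.
Qed.

Lemma sphere_bmX r f k : sphere_bm r f -> sphere_bm r (fun v => f v ^+ k).
Proof.
move=> hf; elim: k => [|k IH].
  by under [X in sphere_bm r X]funext do rewrite expr0; exact: sphere_bm_cst.
by under [X in sphere_bm r X]funext do rewrite exprS; exact: sphere_bmM.
Qed.

Lemma sphere_avgD r f g : sphere_bm r f -> sphere_bm r g ->
  sphere_avg r (fun v => f v + g v) = sphere_avg r f + sphere_avg r g.
Proof.
move=> bf bg; rewrite /sphere_avg -mulrDl; congr (_ / _).
rewrite -cube_intD; [|exact: (bmM bm_ball_ind bf)|exact: (bmM bm_ball_ind bg)].
by congr cube_int; apply/funext => y; rewrite mulrDr.
Qed.

Lemma sphere_avgZ r (c : R) f : sphere_bm r f ->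
  sphere_avg r (fun v => c * f v) = c * sphere_avg r f.
Proof.
move=> bf; rewrite /sphere_avg mulrA; congr (_ / _).
rewrite -cube_intZ; last exact: (bmM bm_ball_ind bf).
by congr cube_int; apply/funext => y; rewrite mulrCA.
Qed.

Lemma sphere_avg_cst r (c : R) : sphere_avg (n := n) r (fun=> c) = c.
Proof.
have -> : (fun=> c) = (fun v : 'I_n -> R => c * 1) by apply/funext => v; rewrite mulr1.
rewrite sphere_avgZ; last exact: sphere_bm_cst.
rewrite /sphere_avg (_ : (fun y => _) = ball_ind n); last first.
  by apply/funext => y; rewrite mulr1.
by rewrite divff ?mulr1 // gt_eqF // ball_vol_gt0.
Qed.

Lemma sphere_avg_sum (I : Type) (s : seq I) r (F : I -> ('I_n -> R) -> R) :
  (forall i, sphere_bm r (F i)) ->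
  sphere_avg r (fun v => \sum_(i <- s) F i v) = \sum_(i <- s) sphere_avg r (F i).
Proof.
move=> hF; elim: s => [|i s IH].
  rewrite big_nil -[RHS](sphere_avg_cst r 0); congr sphere_avg.
  by apply/funext => v; rewrite big_nil.
rewrite big_cons -IH -sphere_avgD //; last exact: sphere_bm_sum.
by congr sphere_avg; apply/funext => v; rewrite big_cons.
Qed.

(** The squared norm of [radial r y] is [r ^+ 2] unless the first [n] coordinates of [y] all vanish.
    Such points lie in the hyperplane [y 0 = 0], which [cube_int_neq0] allows to ignore. *)
Lemma sphere_avg_norm r f : (0 < n)%N -> sphere_bm r f ->
  sphere_avg r (fun v => (\sum_i v i ^+ 2) * f v) = r ^+ 2 * sphere_avg r f.
Proof.
move=> n0 bf; rewrite -sphere_avgZ // /sphere_avg; congr (_ / _).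
have bs : sphere_bm r (fun v => \sum_i v i ^+ 2).
  by apply: sphere_bm_sum => i; apply: sphere_bmX; exact: sphere_bm_coord.
apply: cube_int_neq0 => //.
- exact: (bmM bm_ball_ind (bmM bs bf)).
- exact: (bmM bm_ball_ind (bmM (bm_cst _) bf)).
move=> z z0; rewrite -/(radial r z); congr (_ * (_ * _)).
rewrite /radial (eq_bigr (fun i : 'I_n => r ^+ 2 / nnorm n z ^+ 2 * z i ^+ 2)).
  rewrite -mulr_sumr -sqr_nnorm divfK // sqrf_eq0.
  have := ler_nnorm z (Ordinal n0) => /=; rewrite -normr_gt0 in z0.
  by move=> /(lt_le_trans z0) /gt_eqF ->.
by move=> i _; rewrite !exprMn exprVn mulrAC.
Qed.

(** The hypotheses say that the columns of the matrix are orthonormal. *)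
Lemma sum_sqr_plane (y : nat -> R) (i j : 'I_n) (a b c d : R) : i != j ->
  a ^+ 2 + c ^+ 2 = 1 -> b ^+ 2 + d ^+ 2 = 1 -> a * b + c * d = 0 ->
  \sum_(k < n) plane (val i) (val j) a b c d y k ^+ 2 = \sum_(k < n) y k ^+ 2.
Proof.
move=> ij hac hbd hab; have ji : j != i by rewrite eq_sym.
rewrite (bigD1 i) // (bigD1 j) //= [RHS](bigD1 i) // [X in _ = _ + X](bigD1 j) //=.
rewrite !addrA; congr (_ + _); last first.
  apply: eq_bigr => k /andP[ki kj].
  by rewrite /plane -!val_eqE /= in ki kj *; rewrite (negbTE ki) (negbTE kj).
rewrite /plane !eqxx; rewrite -val_eqE /= in ji; rewrite (negbTE ji).
transitivity ((a ^+ 2 + c ^+ 2) * y i ^+ 2 + (b ^+ 2 + d ^+ 2) * y j ^+ 2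
  + 2 * (a * b + c * d) * (y i * y j)); first by ring.
by rewrite hac hbd hab; ring.
Qed.

(** An orthogonal map preserves the norm, hence the ball, and commutes with the radial projection;
    so it carries one integrand to the other. *)
Lemma sphere_avg_plane r f (i j : 'I_n) (a b c d : R) : i != j ->
  a ^+ 2 + c ^+ 2 = 1 -> b ^+ 2 + d ^+ 2 = 1 -> a * b + c * d = 0 ->
  preserving (rev (iota 0 n)) (plane (val i) (val j) a b c d) ->
  sphere_bm r f ->
  sphere_avg r (fun v => f (plane i j a b c d v)) = sphere_avg r f.
Proof.
move=> ij hac hbd hab [mA pA] bf; set A := plane (val i) _ _ _ _ _ in mA pA.
have nA y : nnorm n (A y) = nnorm n y by rewrite /nnorm sum_sqr_plane.
have bA y : ball_ind n (A y) = ball_ind n y by rewrite /ball_ind nA.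
have rA y : plane i j a b c d (radial r y) = radial r (A y).
  apply/funext => k; rewrite /radial nA /plane /A /plane -!val_eqE.
  by case: ifP => _; [|case: ifP => _ //]; ring.
have bg : sphere_bm r (fun v => f (plane i j a b c d v)).
  have [mf [M hM]] := bf; split; last by exists M => y; rewrite rA.
  rewrite (_ : (fun y => _) = (fun y => f (radial r y)) \o A).
    exact: (measurableT_comp mf mA).
  by apply/funext => y; rewrite /= rA.
have [_ [M hM]] := bf.
(* Adding the bound [M] makes the integrands nonnegative, as [preserving] and [cube_int_eint]
   require. *)
suff : sphere_avg r (fun v => f (plane i j a b c d v) + M) =
       sphere_avg r (fun v => f v + M).
  rewrite !sphere_avgD ?sphere_avg_cst //; try exact: sphere_bm_cst.
  exact: addIr.
rewrite /sphere_avg; congr (_ / _).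
pose H y := ball_ind n y * (f (radial r y) + M).
have bH : bounded_measurable H.
  exact: (bmM bm_ball_ind (bmD bf (bm_cst M))).
have H0 y : 0 <= H y.
  rewrite mulr_ge0 ?ball_ind_ge0 //; have := hM y; rewrite ler_norml; lra.
have Hout y k : (k < n)%N -> 1 < `|y k| -> H y = 0.
  by move=> kn yk; rewrite /H (ball_ind_out kn yk) mul0r.
have HA : (fun y => ball_ind n y * (f (plane i j a b c d (radial r y)) + M)) = H \o A.
  by apply/funext => y; rewrite /H /= bA rA.
rewrite -/H -[X in cube_int n X _]/(fun y => ball_ind n y *
   (f (plane i j a b c d (radial r y)) + M)) HA.
apply: EFin_inj; rewrite !cube_int_eint //; last first.
- by move=> y k kn yk; rewrite /= /H bA (ball_ind_out kn yk) mul0r.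
- by move=> y; exact: H0.
- have [mH [N hN]] := bH; split; last by exists N => y; exact: hN.
  exact: (measurableT_comp mH mA).
rewrite -[X in eint _ X _ = _]/((EFin \o H) \o A) pA //.
by apply/measurable_EFinP; exact: bH.1.
Qed.

Lemma mem_axes (i : 'I_n) : val i \in rev (iota 0 n).
Proof. by rewrite mem_rev mem_iota /=. Qed.

Lemma sphere_avg_tperm r f (i j : 'I_n) : sphere_bm r f ->
  sphere_avg r (fun v => f (v \o tperm i j)) = sphere_avg r f.
Proof.
move=> bf; have [->|ij] := eqVneq i j.
  by congr sphere_avg; apply/funext => v; congr f; apply/funext => k; rewrite /= tperm1 perm1.
rewrite -[RHS](@sphere_avg_plane r f i j 0 1 1 0) //; try ring; last first.
  by apply: preserving_swap; rewrite ?mem_axes.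
congr sphere_avg; apply/funext => v; congr f; apply/funext => k; rewrite /plane /=.
case: tpermP => [->|->|/eqP/negbTE -> /eqP/negbTE -> //].
  by rewrite eqxx; ring.
by rewrite eq_sym (negbTE ij) eqxx; ring.
Qed.

Lemma sphere_avg_reflection r f (i : 'I_n) : (1 < n)%N -> sphere_bm r f ->
  sphere_avg r (fun v => f (fun k => (-1) ^+ (k == i) * v k)) = sphere_avg r f.
Proof.
(* To write the reflection as a map of a coordinate plane, a second axis is chosen; this is where
   [1 < n] enters. *)
move=> n1 bf; have [j ij] : exists j, i != j.
  have := ltn_ord i; case: (posnP i) => [i0 _|i0 _].
    by exists (Ordinal n1); rewrite -val_eqE /= i0.
  by exists (Ordinal (ltnW n1)); rewrite -val_eqE /= -lt0n.
rewrite -[RHS](@sphere_avg_plane r f i j (-1) 0 0 1) //; try ring; last first.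
  by apply: preserving_reflection; rewrite ?mem_axes.
congr sphere_avg; apply/funext => v; congr f; apply/funext => k; rewrite /plane /=.
case: eqP => [->|_]; first by ring.
by case: eqP => [->|_]; ring.
Qed.

(* Rotation by pi/4: the shear parameter [sqrt 2 - 1] is [tan (pi/8)]. *)
Lemma sphere_avg_rotation_odd r f (i j : 'I_n) : i != j -> sphere_bm r f ->
  (forall c v, 2 * c ^+ 2 = 1 -> f (plane i j c (- c) c c v) = - f v) ->
  sphere_avg r f = 0.
Proof.
move=> ij bf hf; pose s : R := Num.sqrt 2; pose c := s^-1.
have s2 : s ^+ 2 = 2 by rewrite sqr_sqrtr.
have s0 : s != 0 by rewrite -sqrf_eq0 s2 pnatr_eq0.
have hc : 2 * c ^+ 2 = 1 by rewrite /c exprVn s2 divff ?pnatr_eq0.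
have : sphere_avg r (fun v => f (plane i j c (- c) c c v)) = sphere_avg r f.
  have cs : c * s = 1 by rewrite mulVf.
  have s2c : s = 2 * c by rewrite -s2 expr2 mulfK.
  clearbody c; apply: sphere_avg_plane => //.
  - by rewrite -mulr2n -mulr_natl.
  - by rewrite sqrrN -mulr2n -mulr_natl.
  - by rewrite mulrN addNr.
  - apply: (preserving_rotation (t := s - 1)); rewrite ?mem_axes //.
      by rewrite mulrBl mulrC cs mul1r subKr.
    by rewrite mulrDr mulr1 mulrBl [s * c]mulrC cs mul1r {1}s2c; ring.
under [X in sphere_avg r X]funext do rewrite hf // -mulN1r.
by rewrite sphere_avgZ // => h; lra.
Qed.

End SphereAverage.

(** * Monomials as products of squared coordinates *)

Section Monomials.
Context {R : realType} (n : nat).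
Implicit Types (v : 'I_n -> R) (s : seq 'I_n) (e : 'I_n -> nat).

(** The list encoding makes multiplication by a square a [cons] and a permutation of the coordinates
    a [map]. *)
Definition sqmon s v : R := \prod_(i <- s) v i ^+ 2.

Definition sqcomb (P : seq (R * seq 'I_n)) v : R :=
  \sum_(p <- P) p.1 * sqmon p.2 v.

Lemma sqmon_cons i s v : sqmon (i :: s) v = v i ^+ 2 * sqmon s v.
Proof. exact: big_cons. Qed.

Lemma sqmon_perm s t : perm_eq s t -> sqmon s = sqmon t.
Proof. by move=> st; apply/funext => v; exact: perm_big. Qed.

Lemma sqmon_tperm s i j v : sqmon s (v \o tperm i j) = sqmon (map (tperm i j) s) v.
Proof. by rewrite /sqmon big_map. Qed.

Lemma prod_count (F : 'I_n -> R) s :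
  \prod_(i <- s) F i = \prod_i F i ^+ count_mem i s.
Proof.
elim: s => [|x s IH]; first by rewrite big_nil big1.
rewrite big_cons IH /= [RHS](eq_bigr (fun i => F i ^+ (x == i) * F i ^+ count_mem i s)).
  rewrite big_split /=; congr (_ * _).
  rewrite (bigD1 x) //= eqxx expr1 big1 ?mulr1 // => i ix.
  by rewrite eq_sym (negbTE ix).
by move=> i _; rewrite exprD.
Qed.

Lemma sqmon_monomial s v : sqmon s v = \prod_i v i ^+ (2 * count_mem i s).
Proof. by rewrite /sqmon prod_count; apply: eq_bigr => i _; rewrite exprM. Qed.

Lemma sum_count_mem s : (\sum_i count_mem i s)%N = size s.
Proof.
elim: s => [|x s IH]; first by rewrite big1.
rewrite /= big_split /= IH -add1n; congr addn.
by rewrite (bigD1 x) //= eqxx big1 // => i ix; rewrite eq_sym (negbTE ix).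
Qed.

Lemma even_monomial_sqmon e : (forall i, ~~ odd (e i)) ->
  exists2 s, (2 * size s = \sum_i e i)%N
           & forall v, \prod_i v i ^+ e i = sqmon s v.
Proof.
move=> ev; have e2 i : e i = (2 * (e i)./2)%N.
  by rewrite mul2n -[LHS]odd_double_half (negbTE (ev i)).
(* Each [i] is listed exactly [(e i)./2] times. *)
exists (flatten [seq nseq (e i)./2 i | i <- enum 'I_n]).
  rewrite size_flatten /shape -map_comp sumnE big_map big_enum /= big_distrr /=.
  by apply: eq_bigr => i _; rewrite size_nseq -e2.
move=> v; rewrite /sqmon big_flatten /= big_map big_enum /=.
by apply: eq_bigr => i _; rewrite big_nseq iter_mulr_1 -exprM -e2.
Qed.

Lemma sphere_bm_sqmon (r : R) s : sphere_bm r (sqmon s).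
Proof.
by apply: sphere_bm_prod => i; apply: sphere_bmX; exact: sphere_bm_coord.
Qed.

Lemma sphere_bm_monomial (r : R) e : sphere_bm r (fun v => \prod_i v i ^+ e i).
Proof.
by apply: sphere_bm_prod => i; apply: sphere_bmX; exact: sphere_bm_coord.
Qed.

Lemma sphere_avg_sqcomb (r : R) P :
  sphere_avg r (sqcomb P) = \sum_(p <- P) p.1 * sphere_avg r (sqmon p.2).
Proof.
rewrite sphere_avg_sum => [|p]; last first.
  by apply: sphere_bmM; [exact: sphere_bm_cst | exact: sphere_bm_sqmon].
by apply: eq_bigr => p _; rewrite sphere_avgZ //; exact: sphere_bm_sqmon.
Qed.

End Monomials.

(** * The defect functional of an invariant weight *)

Section DesignDefect.
Context {R : realType} (n : nat) (X : seq 'rV[R]_n) (w : 'rV[R]_n -> R).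
Hypothesis n1 : (1 < n)%N.
Hypothesis uX : uniq X.
Hypothesis symX : fully_symmetric X w.
Implicit Types (u : 'rV[R]_n -> R) (f g : ('I_n -> R) -> R).

Definition defect u f : R :=
  \sum_(x <- X) u x * (f (rvfun x) - sphere_avg (vnorm x) f).

Definition hact_invariant u :=
  forall s e x, x \in X -> u (hact s e x) = u x.

Lemma defectZ u (c : R) f : (forall r, sphere_bm r f) ->
  defect u (fun v => c * f v) = c * defect u f.
Proof.
move=> bf; rewrite /defect mulr_sumr; apply: eq_bigr => x _.
by rewrite sphere_avgZ //; ring.
Qed.

Lemma defect_sum u (I : Type) (s : seq I) (F : I -> ('I_n -> R) -> R) :
  (forall i r, sphere_bm r (F i)) ->
  defect u (fun v => \sum_(i <- s) F i v) = \sum_(i <- s) defect u (F i).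
Proof.
move=> bF; rewrite /defect exchange_big /=; apply: eq_bigr => x _.
by rewrite sphere_avg_sum // -mulr_sumr sumrB.
Qed.

Lemma defect_sqcomb u P :
  defect u (sqcomb P) = \sum_(p <- P) p.1 * defect u (sqmon p.2).
Proof.
rewrite defect_sum => [|p r]; last first.
  by apply: sphere_bmM; [exact: sphere_bm_cst | exact: sphere_bm_sqmon].
by apply: eq_bigr => p _; rewrite defectZ // => r; exact: sphere_bm_sqmon.
Qed.

Lemma defect_cst u (c : R) : defect u (fun=> c) = 0.
Proof. by rewrite /defect big1 // => x _; rewrite sphere_avg_cst subrr mulr0. Qed.

Lemma sqr_vnorm (x : 'rV[R]_n) : vnorm x ^+ 2 = \sum_i x 0 i ^+ 2.
Proof. by rewrite sqr_sqrtr // sumr_ge0 // => i _; exact: sqr_ge0. Qed.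

(** At [x] and on the sphere through [x] the factor is the same number [vnorm x ^+ 2], which moves
    into the weight. *)
Lemma defect_norm u f : (forall r, sphere_bm r f) ->
  defect u (fun v => (\sum_i v i ^+ 2) * f v) =
  defect (fun x => u x * vnorm x ^+ 2) f.
Proof.
move=> bf; apply: eq_bigr => x _; rewrite sphere_avg_norm ?(ltnW n1) //.
by rewrite -sqr_vnorm; ring.
Qed.

Lemma defect_sqmon_sum u s :
  \sum_i defect u (sqmon (i :: s)) = defect (fun x => u x * vnorm x ^+ 2) (sqmon s).
Proof.
rewrite -defect_sum => [|i r]; last exact: sphere_bm_sqmon.
rewrite -defect_norm => [|r]; last exact: sphere_bm_sqmon.
congr defect; apply/funext => v; rewrite mulr_suml.
by apply: eq_bigr => i _; rewrite sqmon_cons.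
Qed.

Lemma hact_inj s e : injective (@hact R n s e).
Proof.
move=> x y /rowP xy; apply/rowP => i; have := xy ((s^-1)%g i).
by rewrite !mxE permKV => /lreg_sign.
Qed.

(** A signed permutation is injective and maps the finite set [X] into itself, hence permutes it. *)
Lemma sum_hact s e (G : 'rV[R]_n -> R) :
  \sum_(x <- X) G (hact s e x) = \sum_(x <- X) G x.
Proof.
rewrite -(big_map (hact s e) predT G); apply: perm_big.
have umX : uniq (map (hact s e) X) by rewrite map_inj_uniq //; exact: hact_inj.
apply: uniq_perm => //.
have sub : {subset map (hact s e) X <= X}.
  by move=> _ /mapP[x xX ->]; rewrite (symX.1 s e).
by have [] := uniq_min_size umX sub; rewrite ?size_map.
Qed.

Lemma defect_hact u f g s e : hact_invariant u ->
  (forall x, g (rvfun x) = f (rvfun (hact s e x))) ->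
  (forall r, sphere_avg r g = sphere_avg r f) -> defect u g = defect u f.
Proof.
move=> iu gf avg; rewrite /defect.
under eq_bigr do rewrite mulrBr; under [RHS]eq_bigr do rewrite mulrBr.
rewrite !sumrB; congr (_ - _); last by apply: eq_bigr => x _; rewrite avg.
rewrite -[RHS](sum_hact s e); apply: eq_big_seq => x xX.
by rewrite gf iu.
Qed.

Lemma defect_tperm u i j s : hact_invariant u ->
  defect u (sqmon (map (tperm i j) s)) = defect u (sqmon s).
Proof.
move=> iu; apply: (defect_hact (s := tperm i j) (e := fun=> false)) => // [x|r].
  rewrite -sqmon_tperm; congr sqmon; apply/funext => k.
  by rewrite /rvfun /= mxE expr0 mul1r.
rewrite -[RHS](sphere_avg_tperm i j); last exact: sphere_bm_sqmon.
by congr sphere_avg; apply/funext => v; rewrite sqmon_tperm.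
Qed.

(** The reflection in the axis [i] negates the monomial and preserves the defect, which is therefore
    its own opposite. *)
Lemma defect_odd_monomial u (e : 'I_n -> nat) i : hact_invariant u -> odd (e i) ->
  defect u (fun v => \prod_k v k ^+ e k) = 0.
Proof.
move=> iu oi; set f := fun v : 'I_n -> R => _.
have fN v : f (fun k => (-1) ^+ (k == i) * v k) = - f v.
  rewrite /f (bigD1 i) //= [in RHS](bigD1 i) //= eqxx expr1 exprMn -signr_odd oi.
  rewrite expr1 mulN1r mulNr; congr (- (_ * _)); apply: eq_bigr => k ki.
  by rewrite (negbTE ki) expr0 mul1r.
have : defect u (fun v => -1 * f v) = defect u f.
  apply: (defect_hact (s := 1%g) (e := fun k => k == i)) => // [x|r].
    rewrite mulN1r -fN; congr f; apply/funext => k.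
    by rewrite /rvfun mxE perm1.
  rewrite -[RHS](sphere_avg_reflection i) //; last exact: sphere_bm_monomial.
  by congr sphere_avg; apply/funext => v; rewrite fN mulN1r.
rewrite defectZ => [|r]; last exact: sphere_bm_monomial.
by move=> h; lra.
Qed.

Lemma hact_invariant_weight k : hact_invariant (fun x => w x * vnorm x ^+ k).
Proof.
move=> s e x xX; congr (_ * _ ^+ _); first exact: (symX.2 s e _ x).
congr Num.sqrt; rewrite [RHS](reindex_inj (@perm_inj _ s)) /=.
by apply: eq_bigr => i _; rewrite mxE exprMn -signr_odd sqrr_sign mul1r.
Qed.

Lemma sum_spectrum (G : R -> 'rV[R]_n -> R) :
  \sum_(r <- spectrum X) \sum_(x <- layer X r) G r x =
  \sum_(x <- X) G (vnorm x) x.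
Proof.
rewrite (eq_bigr (fun r => \sum_(x <- X) if vnorm x == r then G r x else 0)).
  rewrite exchange_big /=; apply: eq_big_seq => x xX.
  rewrite (bigD1_seq (vnorm x)) ?undup_uniq ?mem_undup ?map_f //= eqxx.
  by rewrite big1 ?addr0 // => r; rewrite eq_sym => /negbTE ->.
by move=> r _; rewrite big_filter big_mkcond.
Qed.

(** By linearity monomials suffice; those with an odd exponent have defect 0, and the others are
    products [sqmon s] of degree [2 * size s]. *)
Lemma euclidean_design_sqmon t : euclidean_design X w t <->
  forall s, (2 * size s <= t)%N -> defect w (sqmon s) = 0.
Proof.
have desE f : \sum_(r <- spectrum X) Wr X w r * sphere_avg r f =
    \sum_(x <- X) w x * f (rvfun x) <-> defect w f = 0.
  have -> : \sum_(r <- spectrum X) Wr X w r * sphere_avg r f =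
      \sum_(x <- X) w x * sphere_avg (vnorm x) f.
    rewrite -(sum_spectrum (fun r x => w x * sphere_avg r f)).
    by apply: eq_bigr => r _; rewrite mulr_suml.
  rewrite /defect; under [in X in _ <-> X]eq_bigr do rewrite mulrBr.
  rewrite sumrB; split => [->|/eqP]; first by rewrite subrr.
  by rewrite subr_eq0 => /eqP.
have iw : hact_invariant w.
  by move=> s e x xX; apply: (symX.2 s e _ x).
split=> [des s st|des p degp]; last first.
  apply/desE.
  rewrite (_ : (fun v => _) = (fun v => \sum_(m <- mpoly.msupp p)
      mpoly.mcoeff m p * \prod_i v i ^+ mpoly.fun_of_multinom m i)); last first.
    by apply/funext => v; rewrite mpoly.mevalE.
  rewrite defect_sum => [|m r]; last first.
    by apply: sphere_bmM; [exact: sphere_bm_cst | exact: sphere_bm_monomial].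
  elim: (mpoly.msupp p) degp => [_|m l IH /= /andP[degm /IH degl]].
    by rewrite big_nil.
  rewrite big_cons degl addr0 defectZ => [|r]; last exact: sphere_bm_monomial.
  have [/forallP ev|/forallPn[i /negPn oi]] :=
      boolP [forall i, ~~ odd (mpoly.fun_of_multinom m i)]; last first.
    by rewrite (defect_odd_monomial iw oi) mulr0.
  have [s ss /funext ->] := even_monomial_sqmon (R := R) ev.
  by rewrite des ?mulr0 // ss -mpoly.mdegE.
(* Conversely, the design equation is applied to the monomial whose exponents are twice the
   multiplicities in [s]. *)
pose m : mpoly.multinom n := mpoly.Multinom [tuple (2 * count_mem i s)%N | i < n].
have mE i : mpoly.fun_of_multinom m i = (2 * count_mem i s)%N by rewrite mpoly.mnmE.
have := des (mpoly.mpolyX R m); rewrite mpoly.msuppX /= andbT => /(_ _).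
rewrite desE (_ : (fun v => _) = sqmon s); first apply.
  rewrite mpoly.mdegE (eq_bigr _ (fun i _ => mE i)) -big_distrr /=.
  by rewrite sum_count_mem.
apply/funext => v; rewrite mpoly.mevalX sqmon_monomial.
by apply: eq_bigr => i _; rewrite mE.
Qed.

End DesignDefect.

(** By induction: once [g] matches the tails, the transposition of [g x] and [y] corrects the head
    and fixes the other images, because neither list has repetitions. *)
Lemma uniq_map_perm (T : finType) (s t : seq T) : uniq s -> uniq t ->
  size s = size t -> exists g : {perm T}, map g s = t.
Proof.
elim: s t => [|x s IH] [|y t] //=; first by exists 1%g.
move=> /andP[xs us] /andP[yt ut] [st]; have [g gs] := IH t us ut st.
exists (g * tperm (g x) y)%g; rewrite permM tpermL; congr (_ :: _).
rewrite -[RHS]gs; apply/eq_in_map => z zs; rewrite permM tpermD //.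
  by rewrite (inj_eq perm_inj); apply: contraNneq xs => ->.
by apply: contraNneq yt => ->; rewrite -gs map_f.
Qed.

(** The coefficient left on one unknown after elimination in the degree 8 system of [vanishing4],
    with [N] the dimension. *)
Lemma degree8_pivot_gt0 (R : realFieldType) (N : R) : 4 <= N ->
  0 < 70 * (N - 2) * ((N - 3) * (12 * N + 324)) + (2520 * N + 3780) * (2 * N + 124).
Proof.
move=> N4; apply: ltr_wpDl; last by apply: mulr_gt0; lra.
by rewrite !mulr_ge0 //; lra.
Qed.

(** * Linear systems for moments invariant under permutations of the coordinates *)

Section SymmetricMoments.
Context {R : realType} (n : nat).
Hypothesis n0 : (0 < n)%N.
Implicit Types (phi : seq 'I_n -> R).

(** Shared by the sphere averages of square monomials and by their defects, so that one reduction to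
    patterns serves both. *)
Definition symmetric_moments phi :=
  (forall s t, perm_eq s t -> phi s = phi t) /\
  (forall i j s, phi (map (tperm i j) s) = phi s).

Definition vanishing k phi := forall s, size s = k -> phi s = 0.

(** Indices out of range fall back to the first axis; [val_axis] covers those in range. *)
Definition axis (k : nat) : 'I_n := insubd (Ordinal n0) k.

Definition on_axes phi (p : seq nat) : R := phi (map axis p).

Definition comb (F : seq nat -> R) (P : seq (R * seq nat)) : R :=
  \sum_(p <- P) p.1 * F p.2.

Lemma val_axis k : (k < n)%N -> val (axis k) = k.
Proof. by move=> kn; rewrite val_insubd kn. Qed.

Lemma axis_uniq (q : seq nat) : all (fun k => k < n)%N q -> uniq q ->
  uniq (map axis q).
Proof.
move=> /allP qn uq; rewrite map_inj_in_uniq // => i j /qn jn /qn ln ij.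
by rewrite -(val_axis jn) -(val_axis ln) ij.
Qed.

Lemma symmetric_perm phi (g : 'S_n) s : symmetric_moments phi ->
  phi (map g s) = phi s.
Proof.
move=> [_ sphi]; have [ts -> _] := prod_tpermP g.
elim: ts s => [|t ts IH] s.
  by rewrite big_nil (eq_map (@perm1 _)) map_id.
rewrite big_cons (eq_map (permM _ _)) map_comp IH; exact: sphi.
Qed.

Section Symmetric.
Variable phi : seq 'I_n -> R.
Hypothesis sphi : symmetric_moments phi.
Local Notation psi := (on_axes phi).

(** Some permutation of the coordinates carries the distinct entries of [q] to the first axes, so a
    moment depends only on which of its indices coincide. *)
Lemma phi_pattern x (q : seq 'I_n) (p : seq nat) : uniq q ->
  all (fun k => k < size q)%N p -> phi [seq nth x q k | k <- p] = psi p.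
Proof.
move=> uq /allP pq.
have qn : (size q <= n)%N by rewrite -(card_uniqP uq) -[X in (_ <= X)%N]card_ord max_card.
have qa : all (fun k => k < n)%N (iota 0 (size q)).
  by apply/allP => k; rewrite mem_iota /= add0n => /leq_trans; exact.
have [] := uniq_map_perm uq (axis_uniq qa (iota_uniq _ _)).
  by rewrite size_map size_iota.
move=> g gq; rewrite -(symmetric_perm g _ sphi) -map_comp; congr phi.
apply/eq_in_map => k /pq kq /=.
rewrite -(nth_map _ (g x)) // gq (nth_map 0%N) ?size_iota //.
by rewrite nth_iota.
Qed.

Lemma psi_perm p q : perm_eq p q -> psi p = psi q.
Proof. by move=> pq; apply: sphi.1; exact: perm_map. Qed.

Lemma phi_eq0 x (q : seq 'I_n) (p p0 : seq nat) s : psi p0 = 0 ->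
  perm_eq p p0 -> uniq q -> all (fun k => k < size q)%N p ->
  s = [seq nth x q k | k <- p] -> phi s = 0.
Proof. by move=> h pp uq pq ->; rewrite phi_pattern // (psi_perm pp). Qed.

Lemma psi_pattern (q p : seq nat) : uniq q -> all (fun k => k < n)%N q ->
  all (fun k => k < size q)%N p -> psi [seq nth 0%N q k | k <- p] = psi p.
Proof.
move=> uq qn pq; rewrite -(@phi_pattern (axis 0) (map axis q) p) ?size_map //; last first.
  exact: axis_uniq.
rewrite /on_axes -map_comp; congr phi; apply/eq_in_map => k /(allP pq) kq /=.
by rewrite (nth_map 0%N).
Qed.

Lemma psi_sum m (p : seq nat) : (m < n)%N -> all (fun k => k < m)%N p ->
  \sum_i phi (i :: map axis p) =
  \sum_(k < m) psi (val k :: p) + (n - m)%:R * psi (m :: p).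
Proof.
move=> mn /allP pm.
have pE (i : 'I_n) : (m <= i)%N -> phi (i :: map axis p) = psi (m :: p).
  move=> mi; rewrite -(sphi.2 i (axis m)) /= tpermL; congr (phi (_ :: _)).
  rewrite -[RHS]map_id; apply/eq_in_map => _ /mapP[k /pm km ->].
  have ka := val_axis (ltn_trans km mn).
  rewrite tpermD // -val_eqE /= ka.
    by rewrite gtn_eqF // (leq_trans km).
  by rewrite val_axis // gtn_eqF.
rewrite (bigID (fun i : 'I_n => (i < m)%N)) /=; congr (_ + _).
  rewrite (big_ord_widen_cond n xpredT (fun k => psi (k :: p))) ?(ltnW mn) //=.
  apply: eq_bigr => i im; rewrite /on_axes /=; congr (phi (_ :: _)).
  by apply: val_inj; rewrite /= val_axis.
rewrite (eq_bigr (fun=> psi (m :: p))) => [|i]; last by rewrite -leqNgt => /pE.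
rewrite sumr_const mulr_natl; congr (_ *+ _).
transitivity #|[set i : 'I_n | (m <= i)%N]|.
  by apply: eq_card => i; rewrite [RHS]inE leqNgt.
have -> : [set i : 'I_n | (m <= i)%N] = ~: [set i : 'I_n | (i < m)%N].
  by apply/setP => i; rewrite !inE -leqNgt.
rewrite cardsCs finset.setCK card_ord; congr (_ - _)%N.
rewrite -sum1dep_card -(big_ord_widen_cond n xpredT (fun=> 1%N)) ?(ltnW mn) //.
by rewrite sum1_card card_ord.
Qed.

End Symmetric.

(* A pair [(c, s)] stands for the term [c] times the product of the squares
   [x_(i+1)^2] for [i] in [s], with repetition. *)
Definition P42 : seq (R * seq nat) :=
  [:: (1, [:: 0; 0]%N); (- 6, [:: 0; 1]%N); (1, [:: 1; 1]%N)].

Definition P63 : seq (R * seq nat) :=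
  [:: (2, [:: 0; 0; 0]%N); (2, [:: 1; 1; 1]%N); (2, [:: 2; 2; 2]%N);
      (- 15, [:: 0; 0; 1]%N); (- 15, [:: 1; 1; 0]%N); (- 15, [:: 0; 0; 2]%N);
      (- 15, [:: 2; 2; 0]%N); (- 15, [:: 1; 1; 2]%N); (- 15, [:: 2; 2; 1]%N);
      (180, [:: 0; 1; 2]%N)].

Definition P82 : seq (R * seq nat) :=
  [:: (1, [:: 0; 0; 0; 0]%N); (- 28, [:: 0; 0; 0; 1]%N); (70, [:: 0; 0; 1; 1]%N);
      (- 28, [:: 1; 1; 1; 0]%N); (1, [:: 1; 1; 1; 1]%N)].

(** This list and [triples4] are the index sets of the second and third sums of [f84], made explicit
    for computation. *)
Definition pairs4 : seq (nat * nat) :=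
  [seq p <- [seq (i, j) | i <- iota 0 4, j <- iota 0 4] | uniq [:: p.1; p.2]].

Definition triples4 : seq (nat * (nat * nat)) :=
  [seq t <- [seq (i, p) | i <- iota 0 4, p <- pairs4] |
     uniq [:: t.1; t.2.1; t.2.2] && (t.2.1 < t.2.2)%N].

Definition P84 : seq (R * seq nat) :=
  [seq (3, [:: i; i; i; i]) | i <- iota 0 4] ++
  [seq (- 28, [:: p.1; p.1; p.1; p.2]) | p <- pairs4] ++
  [seq (210, [:: t.1; t.1; t.2.1; t.2.2]) | t <- triples4] ++
  [:: (- 3780, [:: 0; 1; 2; 3]%N)].

Section Combinations.
Variable phi : seq 'I_n -> R.
Hypothesis sphi : symmetric_moments phi.
Hypothesis n3 : (2 < n)%N.
Local Notation psi := (on_axes phi).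

Lemma psi_pattern3 (q p : seq nat) : uniq q -> all (fun k => k < 3)%N q ->
  all (fun k => k < size q)%N p -> psi [seq nth 0%N q k | k <- p] = psi p.
Proof.
move=> uq /allP q3; apply: psi_pattern => //; apply/allP => k /q3 k3.
exact: leq_trans k3 n3.
Qed.

Lemma comb_P42 : comb psi P42 = 2 * psi [:: 0; 0]%N - 6 * psi [:: 0; 1]%N.
Proof.
rewrite /comb /P42 !big_cons big_nil /=.
by rewrite (@psi_pattern3 [:: 1]%N [:: 0; 0]%N) //; ring.
Qed.

Lemma comb_P63 : comb psi P63 =
  6 * psi [:: 0; 0; 0]%N - 90 * psi [:: 0; 0; 1]%N + 180 * psi [:: 0; 1; 2]%N.
Proof.
rewrite /comb /P63 !big_cons big_nil /=.
rewrite (@psi_pattern3 [:: 1]%N [:: 0; 0; 0]%N) //.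
rewrite (@psi_pattern3 [:: 2]%N [:: 0; 0; 0]%N) //.
rewrite (@psi_pattern3 [:: 1; 0]%N [:: 0; 0; 1]%N) //.
rewrite (@psi_pattern3 [:: 0; 2]%N [:: 0; 0; 1]%N) //.
rewrite (@psi_pattern3 [:: 2; 0]%N [:: 0; 0; 1]%N) //.
rewrite (@psi_pattern3 [:: 1; 2]%N [:: 0; 0; 1]%N) //.
rewrite (@psi_pattern3 [:: 2; 1]%N [:: 0; 0; 1]%N) //.
ring.
Qed.

Lemma comb_P82 : comb psi P82 =
  2 * psi [:: 0; 0; 0; 0]%N - 56 * psi [:: 0; 0; 0; 1]%N + 70 * psi [:: 0; 0; 1; 1]%N.
Proof.
rewrite /comb /P82 !big_cons big_nil /=.
rewrite (@psi_pattern3 [:: 1]%N [:: 0; 0; 0; 0]%N) //.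
rewrite (@psi_pattern3 [:: 1; 0]%N [:: 0; 0; 0; 1]%N) //.
ring.
Qed.

Lemma comb_P84 : (3 < n)%N -> comb psi P84 =
  12 * psi [:: 0; 0; 0; 0]%N - 336 * psi [:: 0; 0; 0; 1]%N
  + 2520 * psi [:: 0; 0; 1; 2]%N - 3780 * psi [:: 0; 1; 2; 3]%N.
Proof.
move=> n4; have le4 k : (k < 4)%N -> (k < n)%N by move=> k4; exact: leq_trans k4 n4.
rewrite /comb /P84 !big_cat !big_map.
(* Within each of the three families all terms share a pattern, hence a moment; the families have 4,
   12 and 12 members. *)
rewrite (@eq_big_seq _ _ _ _ _ _ (fun=> 3 * psi [:: 0; 0; 0; 0]%N)); last first.
  move=> i; rewrite mem_iota => /andP[_ i4].
  by rewrite (@psi_pattern _ sphi [:: i] [:: 0; 0; 0; 0]%N) //= le4.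
rewrite (@eq_big_seq _ _ _ _ pairs4 _ (fun=> - 28 * psi [:: 0; 0; 0; 1]%N)); last first.
  move=> p pp; have /allP/(_ _ pp)/= /and3P[u p1 p2] :
    all (fun p => [&& uniq [:: p.1; p.2], p.1 < 4 & p.2 < 4])%N pairs4 by [].
  by rewrite (@psi_pattern _ sphi [:: p.1; p.2] [:: 0; 0; 0; 1]%N) //= !le4.
rewrite (@eq_big_seq _ _ _ _ triples4 _ (fun=> 210 * psi [:: 0; 0; 1; 2]%N)); last first.
  move=> p pp; have /allP/(_ _ pp)/= /and4P[u p1 p2 p3] :
    all (fun p => [&& uniq [:: p.1; p.2.1; p.2.2],
                      p.1 < 4, p.2.1 < 4 & p.2.2 < 4])%N triples4 by [].
  by rewrite (@psi_pattern _ sphi [:: p.1; p.2.1; p.2.2] [:: 0; 0; 1; 2]%N) //= !le4.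
rewrite !big_cons !big_nil /=; ring.
Qed.

(** When [phi] holds the moments of a weight, [phi'] holds those of the weight multiplied by the
    squared norm. *)
Variable phi' : seq 'I_n -> R.
Hypothesis sum_phi : forall s, \sum_i phi (i :: s) = phi' s.

Lemma vanishing_sum k : vanishing k.+1 phi -> vanishing k phi'.
Proof.
by move=> h s sk; rewrite -sum_phi big1 // => i _; apply: h; rewrite /= sk.
Qed.

Lemma comb_vanishing k P : all (fun p => size p.2 == k) P ->
  vanishing k phi -> comb psi P = 0.
Proof.
move=> /allP Pk h; rewrite /comb big1_seq // => p /= /Pk/eqP pk.
by rewrite /on_axes h ?mulr0 // size_map.
Qed.

(** Each monomial of the lower degree gives one linear equation between moments; n - m counts the
    axes from [m] on. *)
Lemma psi_relation m p : (m < n)%N -> all (fun k => k < m)%N p ->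
  vanishing (size p) phi' ->
  \sum_(k < m) psi (val k :: p) + (n%:R - m%:R) * psi (m :: p) = 0.
Proof.
move=> mn pm h; rewrite -natrB ?(ltnW mn) // -psi_sum // sum_phi h //.
by rewrite size_map.
Qed.

Lemma vanishing1 : vanishing 0 phi' -> vanishing 1 phi.
Proof.
move=> h; have := @psi_relation 0 [::] n0 isT h.
rewrite big_ord0 add0r subr0 => /eqP; rewrite mulf_eq0 pnatr_eq0 gtn_eqF //=.
move=> /eqP p0 [|x [|]] //= _.
by rewrite -[LHS]/(phi [seq nth x [:: x] k | k <- [:: 0%N]]) phi_pattern.
Qed.

Let N3 : 3 <= n%:R :> R. Proof. by rewrite ler_nat. Qed.

(** With a and b the moments of x1^4 and x1^2 x2^2, the system is a + (n - 1) b = 0 and a = 3 b, so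
    (n + 2) b = 0. *)
Lemma vanishing2 : vanishing 1 phi' -> comb psi P42 = 0 -> vanishing 2 phi.
Proof.
rewrite comb_P42 => h h42.
have := @psi_relation 1 [:: 0]%N (ltnW n3) isT h.
rewrite big_ord1 /= (@psi_perm _ sphi [:: 1; 0]%N [:: 0; 1]%N) // => h1.
move: h42 h1 N3; set a := psi [:: 0; 0]%N; set b := psi [:: 0; 1]%N.
move=> h42 h1 hN.
have b0 : b = 0.
  have : b * (n%:R + 2) = 0 by lra.
  by move=> /eqP; rewrite mulf_eq0 => /orP[/eqP //|/eqP]; lra.
have a0 : a = 0 by lra.
move=> [|x [|y [|]]] //= _.
have [<-|xy] := eqVneq x y.
  by apply: (@phi_eq0 _ sphi x [:: x] [:: 0; 0]%N [:: 0; 0]%N).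
by apply: (@phi_eq0 _ sphi x [:: x; y] [:: 0; 1]%N [:: 0; 1]%N) => //=;
  rewrite !inE ?negb_or xy.
Qed.

(** For the patterns 3, 2+1 and 1+1+1 the system is a + (n - 1) b = 0, 2 b + (n - 2) c = 0 and 6 a -
    90 b + 180 c = 0; substitution leaves a positive multiple of c. *)
Lemma vanishing3 : vanishing 2 phi' -> comb psi P63 = 0 -> vanishing 3 phi.
Proof.
rewrite comb_P63 => h h63.
have := @psi_relation 1 [:: 0; 0]%N (ltnW n3) isT h.
rewrite big_ord1 /= (@psi_perm _ sphi [:: 1; 0; 0]%N [:: 0; 0; 1]%N) // => h1.
have := @psi_relation 2 [:: 0; 1]%N n3 isT h.
rewrite !big_ord_recl big_ord0 /= /bump /=.
rewrite (@psi_perm _ sphi [:: 2; 0; 1]%N [:: 0; 1; 2]%N) //.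
rewrite (@psi_pattern3 [:: 1; 0]%N [:: 0; 1; 0]%N) //.
rewrite (@psi_perm _ sphi [:: 0; 1; 0]%N [:: 0; 0; 1]%N) // => h2.
move: h63 h1 h2 N3; set a := psi [:: 0; 0; 0]%N; set b := psi [:: 0; 0; 1]%N.
set c := psi [:: 0; 1; 2]%N => h63 h1 h2 hN.
have c0 : c = 0.
  have hb : b = - ((n%:R - 2) / 2) * c by lra.
  have ha : a = (n%:R - 1) * ((n%:R - 2) / 2) * c by rewrite hb in h1; lra.
  have : c * (3 * (n%:R - 1) * (n%:R - 2) + 45 * (n%:R - 2) + 180) = 0.
    by rewrite -h63 ha hb; field.
  move=> /eqP; rewrite mulf_eq0 => /orP[/eqP //|/eqP]; nra.
have b0 : b = 0 by rewrite c0 in h2; lra.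
have a0 : a = 0 by rewrite b0 in h1; lra.
move=> [|x [|y [|z [|]]]] //= _.
have [<-|xy] := eqVneq x y.
  have [<-|xz] := eqVneq x z.
    by apply: (@phi_eq0 _ sphi x [:: x] [:: 0; 0; 0]%N [:: 0; 0; 0]%N).
  by apply: (@phi_eq0 _ sphi x [:: x; z] [:: 0; 0; 1]%N [:: 0; 0; 1]%N) => //=;
    rewrite !inE ?negb_or xz.
have [<-|xz] := eqVneq x z.
  by apply: (@phi_eq0 _ sphi x [:: x; y] [:: 0; 1; 0]%N [:: 0; 0; 1]%N) => //=;
    rewrite !inE ?negb_or xy.
have [<-|yz] := eqVneq y z.
  by apply: (@phi_eq0 _ sphi x [:: y; x] [:: 1; 0; 0]%N [:: 0; 0; 1]%N) => //=;
    rewrite !inE ?negb_or [y == x]eq_sym xy.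
by apply: (@phi_eq0 _ sphi x [:: x; y; z] [:: 0; 1; 2]%N [:: 0; 1; 2]%N) => //=;
  rewrite !inE ?negb_or xy xz yz.
Qed.

(** The five patterns of four indices are the unknowns; three equations come from [phi'] and two
    from the harmonic polynomials. *)
Lemma vanishing4 : (3 < n)%N -> vanishing 3 phi' ->
  comb psi P82 = 0 -> comb psi P84 = 0 -> vanishing 4 phi.
Proof.
move=> n4 h; rewrite comb_P82 comb_P84 // => h82 h84.
have := @psi_relation 1 [:: 0; 0; 0]%N (ltnW n3) isT h.
rewrite big_ord1 /= (@psi_perm _ sphi [:: 1; 0; 0; 0]%N [:: 0; 0; 0; 1]%N) // => h1.
have := @psi_relation 2 [:: 0; 0; 1]%N n3 isT h.
rewrite !big_ord_recl big_ord0 /= /bump /=.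
rewrite (@psi_perm _ sphi [:: 1; 0; 0; 1]%N [:: 0; 0; 1; 1]%N) //.
rewrite (@psi_perm _ sphi [:: 2; 0; 0; 1]%N [:: 0; 0; 1; 2]%N) // => h2.
have := @psi_relation 3 [:: 0; 1; 2]%N n4 isT h.
rewrite !big_ord_recl big_ord0 /= /bump /=.
rewrite (@psi_pattern3 [:: 1; 0; 2]%N [:: 0; 1; 0; 2]%N) //.
rewrite (@psi_pattern3 [:: 2; 0; 1]%N [:: 0; 1; 2; 0]%N) //.
rewrite (@psi_perm _ sphi [:: 0; 1; 0; 2]%N [:: 0; 0; 1; 2]%N) //.
rewrite (@psi_perm _ sphi [:: 0; 1; 2; 0]%N [:: 0; 0; 1; 2]%N) //.
rewrite (@psi_perm _ sphi [:: 3; 0; 1; 2]%N [:: 0; 1; 2; 3]%N) // => h3.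
have N4 : 4 <= n%:R :> R by rewrite ler_nat.
move: h82 h84 h1 h2 h3; set a := psi [:: 0; 0; 0; 0]%N.
set b := psi [:: 0; 0; 0; 1]%N; set c := psi [:: 0; 0; 1; 1]%N.
set d := psi [:: 0; 0; 1; 2]%N; set e := psi [:: 0; 1; 2; 3]%N.
set N : R := n%:R in N4 * => h82 h84 h1 h2 h3.
(* Eliminating a, c and e leaves [hd] and [hbd], two equations in b and d, which combine to
   [K * b = 0]. *)
have hd : 70 * (N - 2) * d = - (2 * N + 124) * b by lra.
have he : (N - 3) * e = - 3 * d by lra.
have hbd : (N - 3) * (12 * N + 324) * b = (2520 * N + 3780) * d.
  have -> : (N - 3) * (12 * N + 324) * b =
      (N - 3) * (2520 * d) - 3780 * ((N - 3) * e).
    have ha : a = - (N - 1) * b by lra.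
    have : 3780 * e = - (12 * N + 324) * b + 2520 * d by rewrite ha in h84; lra.
    by move=> h5; rewrite [3780 * _]mulrCA h5; ring.
  by rewrite he; ring.
have K0 := degree8_pivot_gt0 N4; set K := (X in 0 < X) in K0.
have b0 : b = 0.
  have : K * b = 0.
    rewrite /K mulrDl -mulrA hbd.
    have -> : 70 * (N - 2) * ((2520 * N + 3780) * d) =
        (2520 * N + 3780) * (70 * (N - 2) * d) by ring.
    by rewrite hd; ring.
  by move=> /eqP; rewrite mulf_eq0 (gt_eqF K0) => /eqP.
have d0 : d = 0.
  move: hd; rewrite b0 mulr0 => /eqP; rewrite mulf_eq0 => /orP[/eqP|/eqP //]; lra.
have e0 : e = 0.
  move: he; rewrite d0 mulr0 => /eqP; rewrite mulf_eq0 => /orP[/eqP|/eqP //]; lra.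
have a0 : a = 0 by rewrite b0 in h1; lra.
have c0 : c = 0 by rewrite b0 d0 in h2; lra.
(* Each way in which the four indices can coincide is a reordering of one of the five patterns. *)
move=> [|x [|y [|z [|u [|]]]]] //= _.
have [<-|xy] := eqVneq x y.
  have [<-|xz] := eqVneq x z.
    have [<-|xu] := eqVneq x u.
      by apply: (@phi_eq0 _ sphi x [:: x] [:: 0; 0; 0; 0]%N [:: 0; 0; 0; 0]%N).
    by apply: (@phi_eq0 _ sphi x [:: x; u] [:: 0; 0; 0; 1]%N [:: 0; 0; 0; 1]%N) => //=;
      rewrite !inE ?negb_or xu.
  have [<-|xu] := eqVneq x u.
    by apply: (@phi_eq0 _ sphi x [:: x; z] [:: 0; 0; 1; 0]%N [:: 0; 0; 0; 1]%N) => //=;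
      rewrite !inE ?negb_or xz.
  have [<-|zu] := eqVneq z u.
    by apply: (@phi_eq0 _ sphi x [:: x; z] [:: 0; 0; 1; 1]%N [:: 0; 0; 1; 1]%N) => //=;
      rewrite !inE ?negb_or xz.
  by apply: (@phi_eq0 _ sphi x [:: x; z; u] [:: 0; 0; 1; 2]%N [:: 0; 0; 1; 2]%N) => //=;
    rewrite !inE ?negb_or xz xu zu.
have [<-|xz] := eqVneq x z.
  have [<-|xu] := eqVneq x u.
    by apply: (@phi_eq0 _ sphi x [:: x; y] [:: 0; 1; 0; 0]%N [:: 0; 0; 0; 1]%N) => //=;
      rewrite !inE ?negb_or xy.
  have [<-|yu] := eqVneq y u.
    by apply: (@phi_eq0 _ sphi x [:: x; y] [:: 0; 1; 0; 1]%N [:: 0; 0; 1; 1]%N) => //=;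
      rewrite !inE ?negb_or xy.
  by apply: (@phi_eq0 _ sphi x [:: x; y; u] [:: 0; 1; 0; 2]%N [:: 0; 0; 1; 2]%N) => //=;
    rewrite !inE ?negb_or xy xu yu.
have [<-|yz] := eqVneq y z.
  have [<-|xu] := eqVneq x u.
    by apply: (@phi_eq0 _ sphi x [:: x; y] [:: 0; 1; 1; 0]%N [:: 0; 0; 1; 1]%N) => //=;
      rewrite !inE ?negb_or xy.
  have [<-|yu] := eqVneq y u.
    by apply: (@phi_eq0 _ sphi x [:: y; x] [:: 1; 0; 0; 0]%N [:: 0; 0; 0; 1]%N) => //=;
      rewrite !inE ?negb_or [y == x]eq_sym xy.
  by apply: (@phi_eq0 _ sphi x [:: y; x; u] [:: 1; 0; 0; 2]%N [:: 0; 0; 1; 2]%N) => //=;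
    rewrite !inE ?negb_or [y == x]eq_sym xy yu xu.
have [<-|xu] := eqVneq x u.
  by apply: (@phi_eq0 _ sphi x [:: x; y; z] [:: 0; 1; 2; 0]%N [:: 0; 0; 1; 2]%N) => //=;
    rewrite !inE ?negb_or xy xz yz.
have [<-|yu] := eqVneq y u.
  by apply: (@phi_eq0 _ sphi x [:: y; x; z] [:: 1; 0; 2; 0]%N [:: 0; 0; 1; 2]%N) => //=;
    rewrite !inE ?negb_or [y == x]eq_sym xy yz xz.
have [<-|zu] := eqVneq z u.
  by apply: (@phi_eq0 _ sphi x [:: z; x; y] [:: 1; 2; 0; 0]%N [:: 0; 0; 1; 2]%N) => //=;
    rewrite !inE ?negb_or [z == x]eq_sym xz [z == y]eq_sym yz xy.
by apply: (@phi_eq0 _ sphi x [:: x; y; z; u] [:: 0; 1; 2; 3]%N [:: 0; 1; 2; 3]%N) => //=;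
  rewrite !inE ?negb_or xy xz xu yz yu zu.
Qed.

End Combinations.
End SymmetricMoments.

(** * Relations between the moments of a sphere *)

Section SphereMoments.
Context {R : realType} (n : nat) (r : R).
Hypothesis n3 : (2 < n)%N.
Let n0 : (0 < n)%N := ltnW (ltnW n3).
Local Notation m := (fun s : seq 'I_n => sphere_avg r (@sqmon R n s)).
Local Notation psi := (on_axes n0 m).

Lemma symmetric_sphere_moments : symmetric_moments m.
Proof.
split=> [s t st|i j s]; first by rewrite (sqmon_perm st).
rewrite -[RHS](sphere_avg_tperm i j); last exact: sphere_bm_sqmon.
by congr sphere_avg; apply/funext => v; rewrite sqmon_tperm.
Qed.

(** The quartic factor is the real part of the fourth power of the complex number with parts [v i]
    and [v j], so rotation by pi/4 negates it; the sum of squares is invariant, and [sqmon s] avoids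
    the rotated axes. *)
Lemma sphere_avg_sqcomb_odd (i j : 'I_n) e s P : i != j -> i \notin s -> j \notin s ->
  (forall v, sqcomb P v = (v i ^+ 4 - 6 * v i ^+ 2 * v j ^+ 2 + v j ^+ 4) *
     (v i ^+ 2 + v j ^+ 2) ^+ e * sqmon s v) ->
  \sum_(p <- P) p.1 * m p.2 = 0.
Proof.
move=> ij is_ js hP; rewrite -sphere_avg_sqcomb.
apply: (sphere_avg_rotation_odd ij) => [|c v c2].
  apply: sphere_bm_sum => p.
  by apply: sphere_bmM; [exact: sphere_bm_cst | exact: sphere_bm_sqmon].
rewrite !hP; have -> : sqmon s (plane i j c (- c) c c v) = sqmon s v.
  apply: eq_big_seq => k ks; rewrite /plane.
  by rewrite !ifF //; apply: contraTF ks => /eqP ->.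
rewrite /plane eqxx [j == i]eq_sym (negbTE ij) eqxx.
set a := v i; set b := v j.
have -> : (c * a + - c * b) ^+ 2 + (c * a + c * b) ^+ 2 = 2 * c ^+ 2 * (a ^+ 2 + b ^+ 2).
  by ring.
rewrite c2 mul1r -[RHS]mulNr -[in RHS]mulNr; congr (_ * _ * _).
transitivity (- (2 * c ^+ 2) ^+ 2 * (a ^+ 4 - 6 * a ^+ 2 * b ^+ 2 + b ^+ 4)).
  by ring.
by rewrite c2 expr1n mulN1r.
Qed.

Lemma axis_neq i j : (i < n)%N -> (j < n)%N -> i != j -> axis n0 i != axis n0 j.
Proof. by move=> ni nj; apply: contra_neq => /(congr1 val); rewrite !val_axis. Qed.

Lemma notin_axes i p : (i < n)%N -> all (fun k => k < n)%N p -> i \notin p ->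
  axis n0 i \notin map (axis n0) p.
Proof.
move=> ni /allP pn; apply: contra => /mapP[k kp /(congr1 val)].
by rewrite !val_axis //; [move=> -> | exact: pn].
Qed.

(** The variables [x] and [y] stand for the squares of the first two coordinates and [p] for the
    remaining factors, so a polynomial identity in two variables becomes a relation between
    moments. *)
Lemma sphere_moments_rotation e p (Q : seq (R * seq nat)) :
  all (fun k => 1 < k < n)%N p -> all (fun t => all (fun k => k < 2)%N t.2) Q ->
  (forall x y : R, comb (fun q => \prod_(k <- q) nth 0 [:: x; y] k) Q =
     (x ^+ 2 - 6 * x * y + y ^+ 2) * (x + y) ^+ e) ->
  comb (fun q => psi (q ++ p)) Q = 0.
Proof.
move=> /allP hp /allP Q2 hQ.
have pn : all (fun k => k < n)%N p by apply/allP => k /hp/andP[].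
have np i : (i < 2)%N -> axis n0 i \notin map (axis n0) p.
  move=> i2; apply: notin_axes => //; first exact: leq_trans i2 (ltnW n3).
  by apply/negP => /hp/andP[+ _]; rewrite ltnNge -ltnS i2.
have := @sphere_avg_sqcomb_odd (axis n0 0) (axis n0 1) e (map (axis n0) p)
  [seq (t.1, map (axis n0) (t.2 ++ p)) | t <- Q].
rewrite big_map /= => h; apply: h; rewrite ?np //.
  by apply: axis_neq => //; exact: ltnW.
move=> v; set x := v (axis n0 0); set y := v (axis n0 1).
rewrite /sqcomb big_map /=.
transitivity (comb (fun q => \prod_(k <- q) nth 0 [:: x ^+ 2; y ^+ 2] k) Q *
  sqmon (map (axis n0) p) v); last by rewrite hQ; congr (_ * _ * _); ring.
rewrite /comb mulr_suml; apply: eq_big_seq => t tQ.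
rewrite map_cat /sqmon big_cat /= mulrA !big_map; congr (_ * _ * _).
by apply: eq_big_seq => k /(allP (Q2 _ tQ)); case: k => [|[|]].
Qed.

Lemma sphere_moments4 p : all (fun k => 1 < k < n)%N p ->
  psi [:: 0, 0 & p]%N - 6 * psi [:: 0, 1 & p]%N + psi [:: 1, 1 & p]%N = 0.
Proof.
move=> hp.
have := @sphere_moments_rotation 0 p
  [:: (1, [:: 0; 0]%N); (- 6, [:: 0; 1]%N); (1, [:: 1; 1]%N)] hp isT.
rewrite /comb !big_cons big_nil /= mul1r mul1r addr0 mulNr addrA; apply => x y.
by rewrite !big_cons !big_nil /=; ring.
Qed.

(** The coefficients are those of (x^2 - 6 x y + y^2) (x + y). *)
Lemma sphere_moments6 p : all (fun k => 1 < k < n)%N p ->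
  psi [:: 0, 0, 0 & p]%N - 5 * psi [:: 0, 0, 1 & p]%N
  - 5 * psi [:: 1, 1, 0 & p]%N + psi [:: 1, 1, 1 & p]%N = 0.
Proof.
move=> hp.
have := @sphere_moments_rotation 1 p
  [:: (1, [:: 0; 0; 0]%N); (- 5, [:: 0; 0; 1]%N);
      (- 5, [:: 1; 1; 0]%N); (1, [:: 1; 1; 1]%N)] hp isT.
rewrite /comb !big_cons big_nil /= mul1r mul1r addr0 !mulNr !addrA; apply => x y.
by rewrite !big_cons !big_nil /=; ring.
Qed.

(** The coefficients are those of (x^2 - 6 x y + y^2) (x + y)^2. *)
Lemma sphere_moments8 :
  psi [:: 0; 0; 0; 0]%N - 4 * psi [:: 0; 0; 0; 1]%N - 10 * psi [:: 0; 0; 1; 1]%N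
  - 4 * psi [:: 1; 1; 1; 0]%N + psi [:: 1; 1; 1; 1]%N = 0.
Proof.
have := @sphere_moments_rotation 2 [::]
  [:: (1, [:: 0; 0; 0; 0]%N); (- 4, [:: 0; 0; 0; 1]%N); (- 10, [:: 0; 0; 1; 1]%N);
      (- 4, [:: 1; 1; 1; 0]%N); (1, [:: 1; 1; 1; 1]%N)] isT isT.
rewrite /comb !big_cons big_nil /= mul1r mul1r addr0 !mulNr !addrA; apply => x y.
by rewrite !big_cons !big_nil /=; ring.
Qed.

Let sm := symmetric_sphere_moments.

Lemma sphere_comb_P42 : comb psi P42 = 0.
Proof.
rewrite comb_P42 //; have := @sphere_moments4 [::] isT.
by rewrite (@psi_pattern3 _ _ _ _ sm n3 [:: 1]%N [:: 0; 0]%N) // => h; lra.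
Qed.

(** The moments for the patterns 3, 2+1 and 1+1+1 are in the ratio 15 : 3 : 1, and 6 * 15 - 90 * 3 +
    180 = 0. *)
Lemma sphere_comb_P63 : comb psi P63 = 0.
Proof.
rewrite comb_P63 //; have := @sphere_moments6 [::] isT.
rewrite (@psi_pattern3 _ _ _ _ sm n3 [:: 1]%N [:: 0; 0; 0]%N) //.
rewrite (@psi_pattern3 _ _ _ _ sm n3 [:: 1; 0]%N [:: 0; 0; 1]%N) // => h6.
have := @sphere_moments4 [:: 2]%N; rewrite /= n3 => /(_ isT).
rewrite (@psi_pattern3 _ _ _ _ sm n3 [:: 1; 2]%N [:: 0; 0; 1]%N) //.
by rewrite (@psi_pattern3 _ _ _ _ sm n3 [:: 0; 2]%N [:: 0; 0; 1]%N) // => h4; lra.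
Qed.

(** The three rotation relations, of degrees 8, 6 and 4, are completed to degree 8 by the powers 0,
    2 and 4 of a third coordinate. *)
Lemma sphere_moments_degree8 :
  [/\ psi [:: 0; 0; 0; 0]%N = 35 * psi [:: 0; 0; 1; 2]%N,
      psi [:: 0; 0; 0; 1]%N = 5 * psi [:: 0; 0; 1; 2]%N
    & psi [:: 0; 0; 1; 1]%N = 3 * psi [:: 0; 0; 1; 2]%N].
Proof.
have := sphere_moments8.
rewrite (@psi_pattern3 _ _ _ _ sm n3 [:: 1]%N [:: 0; 0; 0; 0]%N) //.
rewrite (@psi_pattern3 _ _ _ _ sm n3 [:: 1; 0]%N [:: 0; 0; 0; 1]%N) // => h8.
have := @sphere_moments6 [:: 2]%N; rewrite /= n3 => /(_ isT).
rewrite (@psi_pattern3 _ _ _ _ sm n3 [:: 0; 2]%N [:: 0; 0; 0; 1]%N) //.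
rewrite (@psi_pattern3 _ _ _ _ sm n3 [:: 1; 2]%N [:: 0; 0; 0; 1]%N) //.
rewrite (@psi_pattern3 _ _ _ _ sm n3 [:: 1; 0; 2]%N [:: 0; 0; 1; 2]%N) // => h6.
have := @sphere_moments4 [:: 2; 2]%N; rewrite /= n3 => /(_ isT).
rewrite (@psi_pattern3 _ _ _ _ sm n3 [:: 0; 2]%N [:: 0; 0; 1; 1]%N) //.
rewrite (@psi_pattern3 _ _ _ _ sm n3 [:: 1; 2]%N [:: 0; 0; 1; 1]%N) //.
rewrite (@psi_pattern3 _ _ _ _ sm n3 [:: 2; 0; 1]%N [:: 1; 2; 0; 0]%N) //.
rewrite (@psi_perm _ _ _ _ sm [:: 1; 2; 0; 0]%N [:: 0; 0; 1; 2]%N) // => h4.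
by split; lra.
Qed.

Lemma sphere_comb_P82 : comb psi P82 = 0.
Proof. by rewrite comb_P82 //; have [-> -> ->] := sphere_moments_degree8; ring. Qed.

Lemma sphere_comb_P84 : (3 < n)%N -> comb psi P84 = 0.
Proof.
move=> n4; rewrite comb_P84 //; have [-> -> _] := sphere_moments_degree8.
(* With d and e the moments for 2+1+1 and 1+1+1+1, this gives d = 3 e, while 12 * 35 - 336 * 5 +
   2520 = 1260 = 3780 / 3. *)
have := @sphere_moments4 [:: 2; 3]%N; rewrite /= n3 n4 => /(_ isT).
have pat := @psi_pattern _ _ n0 _ sm.
rewrite (pat [:: 0; 2; 3]%N [:: 0; 0; 1; 2]%N) ?(pat [:: 1; 2; 3]%N [:: 0; 0; 1; 2]%N) //=;
  rewrite ?n3 ?n4 ?n0 ?(ltnW n3) // => h; lra.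
Qed.

End SphereMoments.

(** * The design property and the layer sums in terms of moments *)

Section Designs.
Context {R : realType} (n : nat) (X : seq 'rV[R]_n) (w : 'rV[R]_n -> R).
Hypothesis n3 : (2 < n)%N.
Hypothesis uX : uniq X.
Hypothesis symX : fully_symmetric X w.
Let n0 : (0 < n)%N := ltnW (ltnW n3).

(** The index [k] corresponds to the exponent [s] of [layer_sum]; lowering the degree by 2 raises it
    by 1. *)
Definition design_moment k (s : seq 'I_n) : R :=
  defect X (fun x => w x * vnorm x ^+ (2 * k)) (sqmon s).

Lemma symmetric_design_moment k : symmetric_moments (design_moment k).
Proof.
split=> [s t st|i j s]; first by rewrite /design_moment (sqmon_perm st).
apply: (defect_tperm uX symX); exact: (hact_invariant_weight symX).
Qed.

Lemma design_moment_sum k s :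
  \sum_i design_moment k (i :: s) = design_moment k.+1 s.
Proof.
rewrite /design_moment (defect_sqmon_sum X (ltnW n3)); congr defect.
by apply/funext => x; rewrite -mulrA -exprD mulnS addnC.
Qed.

(** Square monomials have even degree, so those of degree at most [2 * k + 1] have at most [k]
    factors. *)
Lemma euclidean_design_vanishing k : euclidean_design X w (2 * k).+1 <->
  forall j, (j <= k)%N -> vanishing j (design_moment 0).
Proof.
rewrite (euclidean_design_sqmon (ltnW n3) uX symX).
have dE s : design_moment 0 s = defect X w (sqmon s).
  by congr defect; apply/funext => x; rewrite mulr1.
split=> [h j jk s sj|h s sk]; last by rewrite -dE (h (size s)) //; lia.
by rewrite dE h // sj; lia.
Qed.

Lemma vanishing_design_moment0 k : vanishing 0 (design_moment k).
Proof.
move=> [] // _; rewrite -[RHS](@defect_cst _ _ X (fun x => w x * vnorm x ^+ (2 * k)) 1).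
by congr defect; apply/funext => v; rewrite /sqmon big_nil.
Qed.

Lemma vanishing_design_moment1 k : vanishing 1 (design_moment k).
Proof.
exact: (vanishing1 n0 (symmetric_design_moment k) (design_moment_sum k)
  (vanishing_design_moment0 k.+1)).
Qed.

(** As the sphere averages of [f] are zero, its defect is the bare sum over [X], which grouped by
    norm is the layer sum. *)
Lemma layer_sum_comb k (f : 'rV[R]_n -> R) P :
  (forall x, f x = comb (fun q => sqmon (map (axis n0) q) (rvfun x)) P) ->
  (forall r, comb (on_axes n0 (fun s => sphere_avg r (@sqmon R n s))) P = 0) ->
  layer_sum X w k f = comb (on_axes n0 (design_moment k)) P.
Proof.
move=> fP LP.
pose Q := [seq (p.1, map (axis n0) p.2) | p <- P].
have -> : comb (on_axes n0 (design_moment k)) P =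
    defect X (fun x => w x * vnorm x ^+ (2 * k)) (sqcomb Q).
  by rewrite defect_sqcomb big_map.
rewrite /layer_sum (sum_spectrum X (fun r x => w x * r ^+ (2 * k) * f x)).
apply: eq_bigr => x _; rewrite sphere_avg_sqcomb big_map /=.
by rewrite [X in _ - X]LP subr0 fP /sqcomb big_map.
Qed.

Lemma coord_axis (x : 'rV[R]_n) k : (k < n)%N ->
  Defs.coord x k = rvfun x (axis n0 k).
Proof. by move=> kn; rewrite /Defs.coord insubT /rvfun; congr (x _ _); apply: val_inj; rewrite val_axis. Qed.

Lemma f42E (x : 'rV[R]_n) :
  f42 x = comb (fun q => sqmon (map (axis n0) q) (rvfun x)) P42.
Proof.
rewrite /f42 !coord_axis ?(ltnW n3) //.
by rewrite /comb !big_cons big_nil /= /sqmon !big_cons big_nil; ring.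
Qed.

Lemma f63E (x : 'rV[R]_n) :
  f63 x = comb (fun q => sqmon (map (axis n0) q) (rvfun x)) P63.
Proof.
rewrite /f63 !coord_axis ?(ltnW n3) //.
by rewrite /comb !big_cons big_nil /= /sqmon !big_cons big_nil; ring.
Qed.

Lemma f82E (x : 'rV[R]_n) :
  f82 x = comb (fun q => sqmon (map (axis n0) q) (rvfun x)) P82.
Proof.
rewrite /f82 !coord_axis ?(ltnW n3) //.
by rewrite /comb !big_cons big_nil /= /sqmon !big_cons big_nil; ring.
Qed.

(** Turns conditional sums into four terms whose conditions compute, so that [ring] can compare
    [f84] with [P84]. *)
Lemma sum_ord4_cond (P : pred 'I_4) (F : 'I_4 -> R) :
  let g i := if P i then F i else 0 in
  \sum_(i < 4 | P i) F i =
  g (@Ordinal 4 0 isT) + g (@Ordinal 4 1 isT) + g (@Ordinal 4 2 isT)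
  + g (@Ordinal 4 3 isT).
Proof.
move=> g; rewrite big_mkcond !big_ord_recl big_ord0 /= addr0 !addrA.
by congr (_ + _ + _ + _); congr (g _); exact: val_inj.
Qed.

Lemma f84E (x : 'rV[R]_n) : (3 < n)%N ->
  f84 x = comb (fun q => sqmon (map (axis n0) q) (rvfun x)) P84.
Proof.
move=> n4; rewrite /f84 /comb /P84 !big_cat !big_map /=.
rewrite /pairs4 /triples4 /= !big_cons !big_nil /= /sqmon !big_cons !big_nil.
rewrite !sum_ord4_cond /= !coord_axis ?(ltnW n3) //.
ring.
Qed.

End Designs.

(** * Assembly of the four claims, degree by degree *)

Theorem theorem1p6 (R : realType) (n : nat) (X : seq 'rV[R]_n)
    (w : 'rV[R]_n -> R) :
  (3 <= n)%N ->
  uniq X ->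
  (forall x, x \in X -> x != 0) ->
  (forall x, x \in X -> 0 < w x) ->
  fully_symmetric X w ->
  (forall x y, x \in X -> y \in X -> vnorm x = vnorm y -> w x = w y) ->
  [/\ euclidean_design X w 3,
      euclidean_design X w 5 <-> layer_sum X w 0 (@f42 R n) = 0,
      euclidean_design X w 7 <->
        (forall s1, (s1 <= 1)%N -> layer_sum X w s1 (@f42 R n) = 0) /\
        layer_sum X w 0 (@f63 R n) = 0
    & (4 <= n)%N ->
      (euclidean_design X w 9 <->
        [/\ forall s1, (s1 <= 2)%N -> layer_sum X w s1 (@f42 R n) = 0,
            forall s2, (s2 <= 1)%N -> layer_sum X w s2 (@f63 R n) = 0,
            layer_sum X w 0 (@f82 R n) = 0
          & layer_sum X w 0 (@f84 R n) = 0])].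
Proof.
move=> n3 uX _ _ symX _.
pose n0 : (0 < n)%N := ltnW (ltnW n3).
pose phi := @design_moment R n X w; pose psi k := on_axes n0 (phi k).
have sphi k : symmetric_moments (phi k) by exact: symmetric_design_moment.
have sum_phi k s : \sum_i phi k (i :: s) = phi k.+1 s.
  exact: design_moment_sum.
have V1 k : vanishing 1 (phi k) by exact: vanishing_design_moment1.
have L42 k : layer_sum X w k (@f42 R n) = comb (psi k) P42.
  by apply: (layer_sum_comb X w (n3 := n3)) => [x|r];
    [exact: f42E | exact: sphere_comb_P42].
have L63 k : layer_sum X w k (@f63 R n) = comb (psi k) P63.
  by apply: (layer_sum_comb X w (n3 := n3)) => [x|r];
    [exact: f63E | exact: sphere_comb_P63].
have L82 k : layer_sum X w k (@f82 R n) = comb (psi k) P82.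
  by apply: (layer_sum_comb X w (n3 := n3)) => [x|r];
    [exact: f82E | exact: sphere_comb_P82].
have V2 k : comb (psi k) P42 = 0 -> vanishing 2 (phi k).
  exact: (vanishing2 (sphi k) n3 (sum_phi k) (V1 k.+1)).
have V3 k : vanishing 2 (phi k.+1) -> comb (psi k) P63 = 0 -> vanishing 3 (phi k).
  exact: (vanishing3 (sphi k) n3 (sum_phi k)).
have down j k : vanishing j.+1 (phi k) -> vanishing j (phi k.+1).
  exact: (vanishing_sum (sum_phi k)).
have zero j k P : all (fun p => size p.2 == j) P -> vanishing j (phi k) ->
    comb (psi k) P = 0 by exact: comb_vanishing.
have des j : euclidean_design X w (2 * j).+1 <->
    forall i, (i <= j)%N -> vanishing i (phi 0%N).
  exact: euclidean_design_vanishing.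
have V0 : vanishing 0 (phi 0%N) by exact: vanishing_design_moment0.
split.
- by apply/(des 1%N) => -[|[|]].
- rewrite L42; split=> [/(des 2%N) h|h]; first exact: zero (h 2%N isT).
  by apply/(des 2%N) => -[|[|[|]]] // _; exact: V2.
- split=> [/(des 3%N) h|[h42 h63]].
    split=> [s1|]; last by rewrite L63; exact: zero (h 3%N isT).
    rewrite L42; case: s1 => [|[|]] // _; first exact: zero (h 2%N isT).
    (* Summing over one index turns vanishing in degree 6 for [w] into vanishing in degree 4 for [w]
       times the squared norm. *)
    by apply: (@zero 2%N) => //; apply: down; exact: (h 3%N isT).
  rewrite L63 in h63; apply/(des 3%N) => -[|[|[|[|]]]] // _.
    by apply: V2; rewrite -L42 h42.
  by apply: V3 => //; apply: V2; rewrite -L42 h42.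
move=> n4; have L84 : layer_sum X w 0 (@f84 R n) = comb (psi 0%N) P84.
  by apply: (layer_sum_comb X w (n3 := n3)) => [x|r];
    [exact: f84E | exact: sphere_comb_P84].
rewrite L82 L84; split=> [/(des 4%N) h|[h42 h63 h82 h84]].
  split=> [s1|s2||].
  - rewrite L42; case: s1 => [|[|[|]]] // _; first exact: zero (h 2%N isT).
      by apply: (@zero 2%N) => //; apply: down; exact: (h 3%N isT).
    (* Two descents lead from degree 8 to degree 4, with the fourth power of the norm in the
       weight. *)
    by apply: (@zero 2%N) => //; exact: (down _ _ (down _ _ (h 4%N isT))).
  - rewrite L63; case: s2 => [|[|]] // _; first exact: zero (h 3%N isT).
    by apply: (@zero 3%N) => //; apply: down; exact: (h 4%N isT).
  - exact: zero (h 4%N isT).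
  - exact: zero (h 4%N isT).
(* Conversely, degree 4 for [k <= 2] gives degree 6 for [k <= 1] and then degree 8 for [k = 0]: each
   step uses the lower degree with one more factor of the squared norm. *)
have V2' k : (k <= 2)%N -> vanishing 2 (phi k).
  by move=> k2; apply: V2; rewrite -L42 h42.
have V3' k : (k <= 1)%N -> vanishing 3 (phi k).
  by move=> k1; apply: V3; [exact: V2' | rewrite -L63 h63].
apply/(des 4%N) => -[|[|[|[|[|]]]]] // _; [exact: V2'|exact: V3'|].
exact: (vanishing4 (sphi 0%N) n3 (sum_phi 0%N) n4 (V3' 1%N isT) h82 h84).
Qed.
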